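(* Let $\epsilon>0$ be a fixed constant. There exists an algorithm that, given an undirected graph $G$ on $n$ vertices, runs in time $2^{\mathcal{O}(\mathsf{vc}(G)/\epsilon)} n^{\mathcal{O}(1)}$ and returns a minimal feedback vertex set of $G$ of size at least $(1-\epsilon)\,\mathsf{opt}(G)$.
   Context: All graphs are finite, simple and undirected. A feedback vertex set (fvs) of a graph $G$ is a set $S\subseteq V(G)$ such that $G-S$ is a forest (acyclic). An fvs $S$ is minimal if no proper subset of $S$ is an fvs. $\mathsf{opt}(G)$ denotes the maximum size of a minimal feedback vertex set of $G$. A vertex cover of $G$ is a set $C\subseteq V(G)$ containing at least one endpoint of every edge; $\mathsf{vc}(G)$ denotes the minimum size of a vertex cover of $G$. *)

(* Defs.v *)
From mathcomp Require Import all_boot.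
From mathcomp Require Import boolp.

Set Implicit Arguments.
Unset Strict Implicit.
Unset Printing Implicit Defensive.

(** * Graphs *)

Record sgraph (V : finType) := SGraph {
  adj :> rel V;
  adj_sym : symmetric adj;
  adj_irr : irreflexive adj
}.

Section Graphs.
Variables (V : finType) (G : sgraph V).

(* The subgraph of G induced by A is a forest.  [ucycle G c] holds of the
   empty sequence and of [:: x; y] for every edge xy; the graph cycles are the
   simple closed walks on at least three vertices. *)
Definition induces_forest (A : {set V}) : Prop :=
  forall c : seq V, {subset c <= A} -> ucycle G c -> 3 <= size c -> False.

Definition fvs (S : {set V}) : bool := `[< induces_forest (~: S) >].

Definition minimal_fvs (S : {set V}) : bool := minset fvs S.

(* There is always a minimal fvs, so the default value 0 of \max is not used. *)
Definition opt : nat := \max_(S : {set V} | minimal_fvs S) #|S|.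

Definition vertex_cover (C : {set V}) : bool :=
  [forall u, forall v, G u v ==> (u \in C) || (v \in C)].

(* The default value #|V| is harmless: [set: V] is a vertex cover. *)
Definition vc : nat := \big[minn/#|V|]_(C : {set V} | vertex_cover C) #|C|.

End Graphs.

(** * Algorithms

   Random-access machine programs over natural numbers, with structured
   control flow, uniform cost and indirect addressing.  The only arithmetic
   operations are addition and truncated subtraction, each adding at most one
   bit to the largest number in use, so that running times are polynomially
   related to those of Turing machines. *)

Record state := State { regs : nat -> nat; cells : nat -> nat }.

Definition upd (f : nat -> nat) (i v : nat) : nat -> nat :=
  fun j => if j == i then v else f j.

Definition set_reg (s : state) (x v : nat) : state :=
  State (upd (regs s) x v) (cells s).

Definition set_cell (s : state) (a v : nat) : state :=
  State (regs s) (upd (cells s) a v).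

Inductive expr :=
| Lit of nat
| Reg of nat
| Fetch of expr
| Add of expr & expr
| Sub of expr & expr.

Fixpoint eval (s : state) (e : expr) : nat :=
  match e with
  | Lit k => k
  | Reg x => regs s x
  | Fetch e1 => cells s (eval s e1)
  | Add e1 e2 => eval s e1 + eval s e2
  | Sub e1 e2 => eval s e1 - eval s e2
  end.

Fixpoint cost (e : expr) : nat :=
  match e with
  | Lit _ | Reg _ => 1
  | Fetch e1 => (cost e1).+1
  | Add e1 e2 | Sub e1 e2 => (cost e1 + cost e2).+1
  end.

(* A test succeeds when its expression is nonzero. *)
Inductive prog :=
| Skip
| Assign of nat & expr
| Store of expr & expr
| Seq of prog & prog
| If of expr & prog & prog
| While of expr & prog.

(* [exec P s t s']: started in s, P halts in s' after t steps. *)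
Inductive exec : prog -> state -> nat -> state -> Prop :=
| exec_skip s : exec Skip s 1 s
| exec_assign x e s :
    exec (Assign x e) s (cost e).+1 (set_reg s x (eval s e))
| exec_store a e s :
    exec (Store a e) s (cost a + cost e).+1 (set_cell s (eval s a) (eval s e))
| exec_seq P Q s1 s2 s3 t1 t2 :
    exec P s1 t1 s2 -> exec Q s2 t2 s3 -> exec (Seq P Q) s1 (t1 + t2) s3
| exec_if_true e P Q s t s' :
    eval s e != 0 -> exec P s t s' -> exec (If e P Q) s (cost e + t).+1 s'
| exec_if_false e P Q s t s' :
    eval s e = 0 -> exec Q s t s' -> exec (If e P Q) s (cost e + t).+1 s'
| exec_while_true e P s1 s2 s3 t1 t2 :
    eval s1 e != 0 -> exec P s1 t1 s2 -> exec (While e P) s2 t2 s3 ->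
    exec (While e P) s1 (cost e + t1 + t2).+1 s3
| exec_while_false e P s :
    eval s e = 0 -> exec (While e P) s (cost e).+1 s.

Lemma exec_det P s t1 s1 t2 s2 :
  exec P s t1 s1 -> exec P s t2 s2 -> t1 = t2 /\ s1 = s2.
Proof.
move=> H; elim: H t2 s2 => {P s t1 s1}; intros;
  match goal with H : exec _ _ ?t ?s |- _ = ?t /\ _ = ?s =>
    inversion H; subst => // end;
  repeat match goal with
  | IH : forall t s, exec ?P ?a t s -> _, H : exec ?P ?a _ _ |- _ =>
      have [? ?] := IH _ _ H; subst; clear H
  | H : is_true (?x != 0), H' : ?x = 0 |- _ => by rewrite H' in H
  end; by [].
Qed.

(* Input: n in register 0 and the adjacency matrix in row-major order in the
   memory cells below n * n; everything else is 0. *)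
Definition input (n : nat) (G : sgraph 'I_n) : state :=
  State (fun x => if x == 0 then n else 0)
        (fun a => [exists u : 'I_n, exists v : 'I_n,
                     (a == u * n + v) && G u v] : nat).

(* Output: the characteristic vector of a vertex set in the first n cells. *)
Definition output (n : nat) (s : state) : {set 'I_n} :=
  [set v : 'I_n | cells s v != 0].

(* Main.v *)
(**
A set [F] induces a forest iff repeatedly deleting vertices of degree at most
one exhausts it, and the minimal feedback vertex sets are the complements of
the maximal induced forests.

Fix a vertex cover [C] of size [k <= 2 * vc G], found greedily, and an optimal
minimal feedback vertex set [S].  Let [X] be the part of [C] outside [S] and
[M] the set of vertices outside [C] with at least two neighbours in [X].  The
vertices of [S] outside [C] all lie in [M], since those with at most one
neighbour in [X] close no cycle.  For [r] about [2 / eps], all sets [X] and,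
when [k + #|M| <= r * k], all subsets of [M] are described by [r * k] binary
digits, so trying every digit string meets [S] itself.  When [M] is larger, it
is enough to start from the digits giving the feedback vertex set
[(C :\: X) :|: M] and extend its complement to a maximal forest: each vertex
of [M] entering that forest has two neighbours in [X], so by counting edges at
most [#|X| <= k] of them do, and what remains has at least
[#|M| - k >= (1 - eps) * (k + #|M|)] elements.
*)
Require Import Defs.
From mathcomp Require Import all_boot all_order all_algebra.
From mathcomp Require Import reals exp.
From mathcomp Require Import boolp zify ring lra.

Set Implicit Arguments.
Unset Strict Implicit.
Unset Printing Implicit Defensive.

(** * Induced forests, degrees and the leaf criterion *)

Section Forests.
Variables (V : finType) (G : sgraph V).
Implicit Types (A B C F S W X Z : {set V}) (u v : V).

Definition deg A v := #|[set u in A | G v u]|.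

Definition forest A : bool := `[< induces_forest G A >].

Lemma deg_sub A B v : A \subset B -> deg A v <= deg B v.
Proof.
move=> /subsetP AB; apply/subset_leq_card/subsetP => u.
by rewrite !inE => /andP[/AB -> ->].
Qed.

Lemma forest_sub A B : A \subset B -> forest B -> forest A.
Proof.
move=> /subsetP AB /asboolP fB; apply/asboolP => c cA; apply: fB => v.
by move/cA/AB.
Qed.

(** Longest path argument: the first vertex [x] of a longest simple path in [B] has a neighbour [y]
    in [B] other than its successor; by maximality [y] lies on the path, which closes a cycle. *)
Lemma deg_gt1_cycle B v0 :
  v0 \in B -> {in B, forall v, 1 < deg B v} -> ~~ forest B.
Proof.
move=> v0B dB; apply/negP => /asboolP fB.
pose P k := [exists t : k.-tuple V, [&& uniq t, all (mem B) t & sorted G t]].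
have P1 : exists k, P k.
  by exists 1; apply/existsP; exists [tuple v0]; rewrite /= v0B.
have Pub k : P k -> k <= #|V|.
  case/existsP => t /and3P[Ut _ _]; rewrite -(size_tuple t).
  by rewrite -(card_uniqP Ut) max_card.
case: (ex_maxnP P1 Pub) => k /existsP[[t /= /eqP st] /and3P[Ut Bt Pt]] kmax.
case: t st Ut Bt Pt => [|x p] /= st Ut Bt Pt.
  have: P 1 by apply/existsP; exists [tuple v0]; rewrite /= v0B.
  by move/kmax; rewrite -st.
have [xB pB] := andP Bt.
have [y] : exists2 y, y \in [set u in B | G x u] & y != head x p.
  have := dB x xB; rewrite /deg => /card_gt1P[a [b [aD bD ab]]].
  case: (eqVneq a (head x p)) => [E|]; last by exists a.
  by exists b => //; rewrite -E eq_sym.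
rewrite inE => /andP[yB Gxy] yh.
have yp : y \in p.
  apply: contraT => yp; suff /kmax: P k.+1 by rewrite ltnn.
  have sz : size [:: y, x & p] == k.+1 by rewrite /= st.
  apply/existsP; exists (Tuple sz) => /=.
  rewrite inE negb_or yp Ut yB Bt Pt adj_sym Gxy !andbT.
  by apply: contraTneq Gxy => ->; rewrite adj_irr.
case/path.splitP: yp yh Ut pB Pt => p1 p2 yh.
rewrite mem_cat negb_or cat_uniq all_cat cat_path -andbA.
case/and5P=> xp1 _ Up1 _ _ /andP[p1B _] /andP[Pp1 _].
(* [p1] is nonempty because [y] is not the successor of [x], so this cycle has at least three
   vertices. *)
apply: (fB (x :: rcons p1 y)).
- by move=> z; rewrite inE => /orP[/eqP->//|]; apply: (allP p1B).
- by rewrite /ucycle /ucycleb /cycle rcons_path last_rcons Pp1 adj_sym Gxy /= xp1.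
- by case: p1 yh {xp1 Up1 p1B Pp1} => //=; rewrite ?eqxx // => a q _; rewrite size_rcons.
Qed.

(** The successor and the predecessor of [v] on the cycle are two neighbours; they differ because
    the cycle has length at least three. *)
Lemma cycle_deg_gt1 c :
  ucycle G c -> 3 <= size c -> {in c, forall v, 1 < deg [set v in c] v}.
Proof.
move=> /andP[Cc Uc] sc v vc.
apply/card_gt1P; exists (next c v), (prev c v).
rewrite !inE mem_next mem_prev vc (next_cycle Cc vc) adj_sym (prev_cycle Cc vc).
split=> //; case/rot_to: vc => i p Ep.
rewrite -(next_rot i Uc) -(prev_rot i Uc) Ep.
have Up : uniq (v :: p) by rewrite -Ep rot_uniq.
have sp : 3 <= size (v :: p) by rewrite -Ep size_rot.
case: p {Ep} Up sp => [|a [|b p]] //= Up _.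
rewrite eqxx; case: ifP => [/eqP E|_]; first by move: Up; rewrite E inE eqxx.
have lb : last b p \in b :: p by rewrite mem_last.
have [vn an _] := and3P Up.
have vbp : v \notin b :: p by apply: contra vn; rewrite [in X in _ -> X]inE => ->; rewrite orbT.
have -> : (if v == b then a else prev_at v v b p) = last b p.
  move: (vbp); rewrite inE negb_or => /andP[/negbTE -> vp].
  elim: p b vp {Up lb an vn vbp} => [|d p IH] b /=; first by rewrite eqxx.
  by rewrite inE negb_or => /andP[/negbTE -> ?]; apply: IH.
by apply: contraNneq an => ->.
Qed.

(** Minimum degree two forces a cycle, and a cycle is itself a set of minimum degree two. This
    criterion replaces cycles in everything that follows. *)
Lemma forestP A :
  reflect (forall B, B \subset A -> B != set0 -> exists2 v, v \in B & deg B v <= 1)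
          (forest A).
Proof.
apply: (iffP idP) => [fA B BA /set0Pn[v0 v0B]|H].
  have [/exists_inP[v vB dv]|/exists_inPn H] :=
    boolP [exists v in B, deg B v <= 1]; first by exists v.
  have /negP[] := deg_gt1_cycle v0B (fun v vB => etrans (ltnNge _ _) (H v vB)).
  exact: forest_sub BA fA.
apply/asboolP => c cA Uc sc.
have [||v] := H [set v in c].
- by apply/subsetP => v; rewrite inE; apply: cA.
- by case: c sc {cA Uc} => // a c _; apply/set0Pn; exists a; rewrite !inE eqxx.
by rewrite inE => vc; rewrite leqNgt (cycle_deg_gt1 Uc sc vc).
Qed.

(* A leaf of G[X :|: W] lies in X and is adjacent to at most one vertex of W. *)
Lemma forest_card X W :
  forest (X :|: W) -> {in W, forall w, 1 < deg X w} ->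
  #|W| <= #|X|.
Proof.
have [m] := ubnP #|X|; elim: m X W => // m IH X W Xm fXW dW.
have [W0|/set0Pn[w0 w0W]] := eqVneq W set0; first by rewrite W0 cards0.
have XW0 : X :|: W != set0 by apply/set0Pn; exists w0; rewrite inE w0W orbT.
have [v vXW dv] := elimT (forestP _) fXW _ (subxx _) XW0.
have vX : v \in X.
  move: vXW; rewrite inE => /orP[//|/dW].
  by rewrite ltnNge (leq_trans (deg_sub v (subsetUl X W)) dv).
(* Delete [v] from [X] and its at most one neighbour from [W]; the other members of [W] keep all
   their neighbours in [X]. *)
pose W' := [set w in W | ~~ G v w].
have WW' : #|W| <= #|W'|.+1.
  rewrite -(cardsID [set w | G v w] W) -addn1 addnC leq_add //.
    by apply/subset_leq_card/subsetP => w; rewrite !inE andbC.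
  apply: leq_trans dv; apply/subset_leq_card/subsetP => w.
  by rewrite !inE => /andP[-> ->]; rewrite orbT.
rewrite (cardsD1 v X) vX add1n; apply: leq_trans WW' _; rewrite ltnS.
apply: IH.
- by move: Xm; rewrite (cardsD1 v X) vX.
- by apply: forest_sub fXW; rewrite setUSS ?subsetDl //; apply/subsetP => w; rewrite inE => /andP[].
move=> w; rewrite inE => /andP[wW nvw].
apply: leq_trans (dW w wW) _; apply/subset_leq_card/subsetP => u.
rewrite !inE => /andP[uX Gwu]; rewrite uX Gwu !andbT.
by apply: contraNneq nvw => <-; rewrite adj_sym.
Qed.

(** * Peeling *)

Definition peel1 A v := if deg A v <= 1 then A :\ v else A.
Definition peel_round A := foldl peel1 A (enum V).
(** [#|V|] rounds suffice: each round deletes a vertex unless the set is already stable. *)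
Definition peel A := iter #|V| peel_round A.

Lemma peel1_sub A v : peel1 A v \subset A.
Proof. by rewrite /peel1; case: ifP; rewrite ?subsetDl. Qed.

Lemma foldl_peel1_sub s A : foldl peel1 A s \subset A.
Proof.
by elim: s A => //= v s IH A; apply: subset_trans (IH _) (peel1_sub _ _).
Qed.

(** Degrees grow with the set, so as long as [B] is contained in the current set no vertex of [B]
    qualifies for deletion. *)
Lemma foldl_peel1_core B s A :
  {in B, forall v, 1 < deg B v} -> B \subset A -> B \subset foldl peel1 A s.
Proof.
move=> dB; elim: s A => //= v s IH A BA; apply: IH.
rewrite /peel1; case: ifP => // dv; rewrite subsetD1 BA /=.
by apply/negP => /dB; rewrite ltnNge (leq_trans (deg_sub v BA) dv).
Qed.

Lemma foldl_peel1_fix s A :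
  foldl peel1 A s = A -> {in s, forall v, v \in A -> 1 < deg A v}.
Proof.
elim: s => //= v s IH E.
have E1 : peel1 A v = A.
  by apply/eqP; rewrite eqEsubset peel1_sub /= -{1}E foldl_peel1_sub.
rewrite E1 in E => w; rewrite inE => /orP[/eqP->|/(IH E)//].
move: E1; rewrite /peel1; case: ifP => [_ <-|]; first by rewrite !inE eqxx.
by rewrite ltnNge => ->.
Qed.

Lemma peel_eq0 A : (peel A == set0) = forest A.
Proof.
apply/idP/idP => [/eqP E|fA].
  apply/forestP => B BA B0.
  have [/exists_inP[v vB dv]|/exists_inPn H] :=
    boolP [exists v in B, deg B v <= 1]; first by exists v.
  suff: B \subset peel A by rewrite E subset0 (negbTE B0).
  rewrite /peel; elim: #|V| => //= k IH.
  by apply: foldl_peel1_core => // v /H; rewrite -ltnNge.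
(* A round that deletes something lowers the cardinality; a round that deletes nothing leaves
   minimum degree two, which in a forest means the empty set. *)
suff H k : iter k peel_round A \subset A /\ #|iter k peel_round A| <= #|V| - k.
  by rewrite -cards_eq0 -leqn0; have [_] := H #|V|; rewrite subnn.
elim: k => [|k [IH1 IH2]] /=; first by rewrite subn0 max_card.
set B := iter k _ A in IH1 IH2 *.
have sB : peel_round B \subset B by apply: foldl_peel1_sub.
split; first exact: subset_trans IH1.
have [EB|nB] := eqVneq (peel_round B) B; last first.
  have := proper_card (_ : peel_round B \proper B).
  rewrite properEneq nB sB => /(_ isT) /leq_trans/(_ IH2).
  by rewrite subnS; case: (_ - k).
have [->|B0] := eqVneq (peel_round B) set0; first by rewrite cards0.
rewrite EB in B0; have [v vB] := elimT (forestP _) fA _ IH1 B0.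
by rewrite leqNgt (foldl_peel1_fix EB) // mem_enum.
Qed.

(** * Maximal forests *)

Definition grow F v := if forest (v |: F) then v |: F else F.
Definition extend F := foldl grow F (enum V).

Lemma foldl_grow_sub s F : F \subset foldl grow F s.
Proof.
elim: s F => //= v s IH F; apply: subset_trans (IH _).
by rewrite /grow; case: ifP => // _; rewrite subsetUr.
Qed.

Lemma foldl_grow_forest s F : forest F -> forest (foldl grow F s).
Proof.
by elim: s F => //= v s IH F fF; apply: IH; rewrite /grow; case: ifP.
Qed.

(** A vertex rejected at its turn closed a cycle with a subset of the final forest, hence still does
    so at the end. *)
Lemma foldl_grow_max s F v :
  v \in s -> forest (v |: foldl grow F s) -> v \in foldl grow F s.
Proof.
elim: s F => //= w s IH F; rewrite inE => /orP[/eqP->|vs]; last exact: IH.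
move=> fw; apply: (subsetP (foldl_grow_sub s _)).
rewrite /grow; case: ifP => [_|/negP[]]; first by rewrite !inE eqxx.
apply: forest_sub fw; rewrite setUS //; apply: subset_trans (foldl_grow_sub s _).
by rewrite /grow; case: ifP => // _; rewrite subsetUr.
Qed.

Lemma extend_sub F : F \subset extend F.
Proof. exact: foldl_grow_sub. Qed.

Lemma extend_forest F : forest F -> forest (extend F).
Proof. exact: foldl_grow_forest. Qed.

Lemma fvsC F : fvs G (~: F) = forest F.
Proof. by rewrite /fvs setCK. Qed.

(** If a smaller feedback vertex set omitted a vertex [v] of the complement, then [v] could still be
    added to the extension. *)
Lemma extend_minimal F : forest F -> minimal_fvs G (~: extend F).
Proof.
move=> fF; apply/minsetP; rewrite fvsC extend_forest //; split=> // B fB BX.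
apply/eqP; rewrite eqEsubset BX /=; apply/subsetP => v vX; apply: contraT => vB.
move: vX; rewrite inE => /negP[]; apply: foldl_grow_max; first by rewrite mem_enum.
apply: forest_sub fB; apply/subsetP => w; rewrite !inE => /orP[/eqP->//|wX].
by apply: contraL wX => /(subsetP BX); rewrite inE.
Qed.

(** The complement of a minimal feedback vertex set is a maximal forest. Hence a candidate equal to
    it yields exactly [S]. *)
Lemma extend_id S : minimal_fvs G S -> extend (~: S) = ~: S.
Proof.
case/minsetP => fS minS; have fS' : forest (~: S) by [].
rewrite -[LHS]setCK; congr (~: _); apply: minS; first by rewrite fvsC extend_forest.
by rewrite -setCS setCK extend_sub.
Qed.

(** * Approximate vertex covers *)

Definition cover_pair C u v :=
  if G u v && (u \notin C) && (v \notin C) then v |: (u |: C) else C.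
Definition cover_row C u := foldl (cover_pair^~ u) C (enum V).
Definition greedy_cover := foldl cover_row set0 (enum V).

(** The property of endpoint sets of matchings that is used. With [C :&: D] in place of [D] it is
    inductive: a new matching edge adds two to the left side and at least two to the right side. *)
Definition matched C := forall D, vertex_cover G D -> #|C| <= 2 * #|C :&: D|.

Lemma cover_pair_sub C u v : C \subset cover_pair C u v.
Proof.
by rewrite /cover_pair; case: ifP => // _; rewrite setUA subsetUr.
Qed.

Lemma card_setU1I v A D : v \notin A -> #|(v |: A) :&: D| = (v \in D) + #|A :&: D|.
Proof.
move=> vA; rewrite (cardsD1 v) !inE eqxx /=; congr (_ + #|pred_of_set _|).
apply/setP => w; rewrite !inE; case: eqVneq => // ->.
by rewrite (negbTE vA).
Qed.

Lemma cover_pair_matched C u v : matched C -> matched (cover_pair C u v).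
Proof.
move=> mC; rewrite /cover_pair; case: ifP => // /andP[/andP[Guv uC] vC] D cD.
have uv : v != u by apply: contraTneq Guv => ->; rewrite adj_irr.
have := mC D cD.
have := forallP (forallP cD u) v; rewrite Guv /= => uvD.
have vuC : v \notin u |: C by rewrite !inE negb_or uv.
rewrite !cardsU1 vuC uC !card_setU1I //.
by case: (v \in D) uvD; case: (u \in D) => //=; lia.
Qed.

Lemma foldl_cover_pair_sub u s C : C \subset foldl (cover_pair^~ u) C s.
Proof.
by elim: s C => //= v s IH C; apply: subset_trans (IH _); apply: cover_pair_sub.
Qed.

Lemma foldl_cover_row_sub s C : C \subset foldl cover_row C s.
Proof.
elim: s C => //= v s IH C; apply: subset_trans (IH _).
exact: foldl_cover_pair_sub.
Qed.

Lemma greedy_cover_matched : matched greedy_cover.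
Proof.
rewrite /greedy_cover; have : matched set0 by move=> D _; rewrite cards0.
elim: (enum V) set0 => //= u s IH C mC; apply: IH; rewrite /cover_row.
by elim: (enum V) C mC => //= v t IHt C mC; apply: IHt; apply: cover_pair_matched.
Qed.

Lemma foldl_cover_pair_cover u s C v :
  v \in s -> G u v ->
  let C' := foldl (cover_pair^~ u) C s in (u \in C') || (v \in C').
Proof.
elim: s C => //= w s IH C; rewrite inE => /orP[/eqP <-|vs]; last exact: IH.
move=> Guv; have /subsetP sub := foldl_cover_pair_sub u s (cover_pair C u v).
suff /orP[/sub->|/sub->] : (u \in cover_pair C u v) || (v \in cover_pair C u v).
- by [].
- by rewrite orbT.
rewrite /cover_pair Guv /=; case: ifP => [_|/negbT].
  by rewrite !inE eqxx orbT.
by rewrite negb_and !negbK.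
Qed.

Lemma greedy_cover_cover : vertex_cover G greedy_cover.
Proof.
apply/forallP => u; apply/forallP => v; apply/implyP => Guv.
have: u \in enum V by rewrite mem_enum.
rewrite /greedy_cover; elim: (enum V) set0 => //= w s IH C.
rewrite inE => /orP[/eqP <-|us]; last exact: IH.
have /subsetP sub := foldl_cover_row_sub s (cover_row C u).
have := foldl_cover_pair_cover C (_ : v \in enum V) Guv.
by rewrite mem_enum => /(_ isT)/= /orP[/sub->|/sub->] //; rewrite orbT.
Qed.

Lemma greedy_cover_card : #|greedy_cover| <= 2 * vc G.
Proof.
have le D : vertex_cover G D -> #|greedy_cover| <= 2 * #|D|.
  move=> cD; apply: leq_trans (greedy_cover_matched cD) _.
  by rewrite leq_mul2l /= subset_leq_card ?subsetIr.
(* The bound must also hold for the default value [#|V|] of the minimum. *)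
rewrite /vc; elim/big_ind: _ => //.
- by apply: leq_trans (max_card _) _; rewrite leq_pmull.
- by move=> x y hx hy; rewrite /minn; case: ifP.
Qed.

(** * Candidate forests *)

(** Mirrors the overwriting of one cell of a characteristic vector by the bit [b]. *)
Definition put (b : bool) v F := if b then v |: F else F :\ v.

Lemma in_put b v F w : (w \in put b v F) = if w == v then b else w \in F.
Proof. by rewrite /put; case: b; rewrite !inE; case: eqVneq. Qed.

Lemma put_id v F : put (v \in F) v F = F.
Proof. by apply/setP => w; rewrite in_put; case: eqVneq => // ->. Qed.

(* The membership of the vertices of [sel] is read off the binary digits of
   [dF.1], that of the other vertices is given by [def]. *)
Definition read (sel def : {set V} -> pred V) (dF : nat * {set V}) v :=
  if sel dF.2 v then (dF.1./2, put (odd dF.1) v dF.2)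
  else (dF.1, put (def dF.2 v) v dF.2).

(** The string [e] that produces [Z] on [s] and leaves [d] unread is built from the last vertex
    back. Every intermediate set agrees at each vertex with [F] or with [Z], so selection has to be
    controlled only between [F :&: Z] and [F :|: Z]. Only members of [A] take a digit; if none of
    them is in [Z], all these digits are zero. *)
Lemma read_onto sel def A Z (s : seq V) F d :
    uniq s ->
    (forall F' v, F :&: Z \subset F' -> F' \subset F :|: Z ->
       if sel F' v then v \in A else def F' v == (v \in Z)) ->
  exists e,
    [/\ foldl (read sel def) (e, F) s = (d, [set w | w \in if w \in s then Z else F]),
        e < 2 ^ count (mem A) s * d.+1
      & [disjoint A & Z] -> d = 0 -> e = 0].
Proof.
elim: s F => [|v s IH] F /=.
  move=> _ _; exists d; rewrite mul1n; split=> //; congr (_, _).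
  by apply/setP => w; rewrite inE.
case/andP=> vs Us H; set F1 := put (v \in Z) v F.
have [F' w sF' F's|e [Ee le_e e0]] := IH F1 Us.
  apply: H; first apply: subset_trans sF'; last apply: subset_trans F's _;
  apply/subsetP => x; rewrite !inE in_put; case: eqVneq => [->|//].
    by move=> /andP[_ ->].
  by rewrite orbb => ->; rewrite orbT.
have /= := H F v (subsetIl _ _) (subsetUl _ _).
have final : [set w | w \in if w \in s then Z else F1] =
    [set w | w \in if w \in v :: s then Z else F].
  apply/setP => w; rewrite !inE; case: (w \in s); rewrite ?orbT ?orbF //.
  by rewrite in_put; case: eqVneq => // ->.
rewrite final in Ee.
case: ifP => selv HFv.
  (* The digit of [v] is read first, so it becomes the lowest one. *)
  exists ((v \in Z) + e.*2); split.
  - rewrite /read /= -/(read _ _) selv.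
    by rewrite half_bit_double oddD odd_double addbF oddb.
  - rewrite HFv add1n expnS -mulnA mul2n.
    case: (v \in Z); rewrite ?add0n ?add1n ?ltn_double //.
    by rewrite -doubleS leq_double in le_e *; lia.
  move=> dAZ d0; rewrite e0 //.
  by rewrite (disjointFr dAZ HFv).
exists e; split=> //.
- by rewrite /read /= -/(read _ _) selv (eqP HFv).
- apply: leq_trans le_e _; rewrite leq_mul2r leq_exp2l ?leq_addl ?orbT //.
Qed.

(** * Candidates over a fixed vertex cover, and the search through them *)

Section Candidates.
Variable C : {set V}.

Definition in_cover F v := v \in C.
(** [F] is the set built so far. Vertices outside a cover are pairwise nonadjacent, so those
    inserted earlier do not affect this degree, see [deg_cover]. *)
Definition branching F v := (v \notin C) && (1 < deg F v).
Definition free F v := (v \notin C) || (v \in F).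

(** The inner pass chooses the part of [C] in the forest. The outer pass spends digits on the
    vertices outside [C] with two chosen neighbours, inserts the others outside [C], and leaves [C]
    as it is. *)
Definition candidate j :=
  (foldl (read branching free)
     (foldl (read in_cover (fun F v => v \in F)) (j, set0) (enum V)) (enum V)).2.

Hypothesis coverC : vertex_cover G C.

Lemma cover_nbr v w : v \notin C -> G v w -> w \in C.
Proof.
move=> vC Gvw; have := forallP (forallP coverC v) w.
by rewrite Gvw (negbTE vC).
Qed.

Lemma deg_cover F v : v \notin C -> deg F v = deg (F :&: C) v.
Proof.
move=> vC; apply: eq_card => w; rewrite !inE -andbA; congr (_ && _).
by apply/idP/andP => [Gvw|[]//]; rewrite (cover_nbr vC Gvw).
Qed.

(** For [X] the part of [C] in the forest, this is the set [M] of the overview: the vertices that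
    take a digit in the outer pass. *)
Definition crossing X := [set v | (v \notin C) && (1 < deg X v)].

Lemma candidate_onto Z :
    (forall v, v \notin C -> v \notin Z -> v \in crossing (Z :&: C)) ->
  exists e,
    [/\ candidate e = Z, e < 2 ^ (#|C| + #|crossing (Z :&: C)|)
      & [disjoint crossing (Z :&: C) & Z] -> e < 2 ^ #|C|].
Proof.
move=> HZ; set X := Z :&: C in HZ *.
have XZ : X \subset Z by apply: subsetIl.
(* The outer pass is solved first, with nothing left over; its string [e2] is then what the inner
   pass must leave unread. *)
have [F v|e2 [E2 le2 z2]] := @read_onto branching free (crossing X) Z _ X 0 (enum_uniq V).
  rewrite (setIidPl XZ) (setUidPr XZ) => XF FZ.
  have FC : F :&: C = X.
    apply/eqP; rewrite eqEsubset setSI //= subsetI XF; exact: subsetIr.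
  rewrite /branching /free; case: (boolP (v \in C)) => vC /=.
    by have /setP/(_ v) := FC; rewrite /X !inE vC !andbT => ->.
  rewrite deg_cover // FC; case: ifP => [dv|dv]; first by rewrite inE vC.
  by rewrite eq_sym eqb_id; apply: contraFT dv => /(HZ v vC); rewrite inE => /andP[].
have [F v|e1 [E1 le1 _]] := @read_onto in_cover (fun F v => v \in F) C X _ set0 e2 (enum_uniq V).
  rewrite set0U /in_cover => _ /subsetP FX; case: ifP => // vC.
  rewrite [v \in X]inE vC andbF eqbF_neg; apply: contraFN vC => /FX.
  by rewrite inE => /andP[].
have enumE (A B : {set V}) : [set w | w \in if w \in enum V then A else B] = A.
  by apply/setP => w; rewrite inE mem_enum.
have cE (A : {set V}) : count (mem A) (enum V) = #|A|.
  rewrite cardE -size_filter; apply/perm_size/uniq_perm; rewrite ?filter_uniq -?enumT ?enum_uniq //.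
  by move=> w; rewrite mem_filter !mem_enum andbT.
rewrite !enumE !cE in E1 E2 le1 le2.
exists e1; split.
- by rewrite /candidate E1 E2.
- apply: leq_trans le1 _; rewrite expnD leq_mul2l.
  by rewrite -[X in _ <= X]muln1 le2 orbT.
- by move=> dZ; move: le1; rewrite z2 // muln1.
Qed.

(** Otherwise [v] would have at most one neighbour in the forest outside [S] and could join it: a
    vertex set containing [v] has [v] itself as a vertex of low degree, and any other one lies in
    the old forest. *)
Lemma minimal_fvs_crossing S v :
  minimal_fvs G S -> v \in S -> v \notin C -> v \in crossing (~: S :&: C).
Proof.
case/minsetP => fS minS vS vC; rewrite inE vC -deg_cover //= ltnNge.
apply/negP => dv; have fS' : forest (~: S) by [].
suff f : forest (~: (S :\ v)).
  by have /setP/(_ v) := minS _ f (subsetDl _ _); rewrite !inE eqxx vS.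
apply/forestP => B; have [vB BS _|vB BS B0] := boolP (v \in B); last first.
  apply: (elimT (forestP _) fS') => //; apply/subsetP => w wB.
  have := subsetP BS w wB; rewrite !inE negb_and negbK => /orP[/eqP E|//].
  by rewrite -E wB in vB.
exists v => //; apply: leq_trans dv; apply/subset_leq_card/subsetP => w.
rewrite !inE => /andP[/(subsetP BS) wS Gvw]; rewrite Gvw andbT.
move: wS; rewrite !inE negb_and negbK => /orP[/eqP E|//].
by rewrite E adj_irr in Gvw.
Qed.

Lemma minimal_fvs_card S :
  minimal_fvs G S -> #|S| <= #|C| + #|crossing (~: S :&: C)|.
Proof.
move=> mS; apply: leq_trans (leq_card_setU _ _).
apply/subset_leq_card/subsetP => v vS; rewrite in_setU -implyNb.
by apply/implyP; apply: minimal_fvs_crossing.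
Qed.

(** By [forest_card], the extension contains at most [#|Z :&: C|] crossing vertices; all others stay
    in its complement. *)
Lemma extend_crossing_card Z :
  forest Z -> #|crossing (Z :&: C)| <= #|~: extend Z| + #|C|.
Proof.
move=> fZ; set M := crossing _; rewrite -(cardsID (extend Z) M) addnC leq_add //.
  by apply/subset_leq_card/subsetP => v; rewrite !inE => /andP[].
apply: leq_trans (subset_leq_card (subsetIr Z C)); apply: forest_card.
- apply: forest_sub (extend_forest fZ); rewrite subUset subsetIr andbT.
  by apply: subset_trans (extend_sub Z); apply: subsetIl.
- by move=> v; rewrite !inE => /andP[/andP[_]].
Qed.

(** The comparison is not strict, so the first forest replaces the initial pair [(0, set0)] even
    when its complement is empty. *)
Definition improve (bB : nat * {set V}) X :=
  if bB.1 <= #|~: X| then (#|~: X|, X) else bB.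
Definition attempt bB j :=
  if forest (candidate j) then improve bB (extend (candidate j)) else bB.
Definition search N := foldl attempt (0, set0) (iota 0 N).

Lemma searchS N : search N.+1 = attempt (search N) N.
Proof. by rewrite /search -addn1 iotaD foldl_cat. Qed.

(** Zero digits choose no vertex of [C], so the candidate is an independent set. Hence the very
    first attempt succeeds. *)
Lemma forest_candidate0 : forest (candidate 0).
Proof.
have e0 s F : foldl (read in_cover (fun F v => v \in F)) (0, F) s = (0, F :\: [set v in s | v \in C]).
  elim: s F => [|v s IH] F /=.
    by congr (_, _); apply/setP => w; rewrite !inE.
  have -> : read in_cover (fun F v => v \in F) (0, F) v = (0, if v \in C then F :\ v else F).
    by rewrite /read /in_cover /=; case: ifP => // _; rewrite put_id.
  rewrite IH; congr (_, _); apply/setP => w; rewrite !inE.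
  by case: ifP => vC; rewrite ?inE; case: eqVneq => //= ->; rewrite vC ?andbF ?andbT.
have sub s d F : F \subset ~: C -> (foldl (read branching free) (d, F) s).2 \subset ~: C.
  elim: s d F => //= v s IH d F FC; case E: read => [d' F']; apply: IH.
  have -> : F' = (read branching free (d, F) v).2 by rewrite E.
  rewrite /read /branching /free /=.
  case: (boolP (v \in C)) => vC /=; first by rewrite put_id.
  have vFC : v |: F \subset ~: C by rewrite subUset sub1set inE vC.
  case: ifP => _ //=; rewrite /put; case: ifP => _ //.
  exact: subset_trans (subD1set _ _) FC.
have : candidate 0 \subset ~: C.
  by rewrite /candidate e0; apply: sub; apply/subsetP => w; rewrite !inE andbF.
move=> sC; apply/forestP => B BC /set0Pn[v vB]; exists v => //.
rewrite leqNgt; apply/negP => /card_gt1P[w [_ [+ _ _]]]; rewrite inE => /andP[wB Gvw].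
have inC x : x \in B -> x \notin C by move=> /(subsetP BC)/(subsetP sC); rewrite inE.
by have := cover_nbr (inC v vB) Gvw; rewrite (negbTE (inC w wB)).
Qed.

Lemma search_minimal N : 0 < N ->
  [/\ minimal_fvs G (~: (search N).2), (search N).1 = #|~: (search N).2|
    & forall j, j < N -> forest (candidate j) ->
      #|~: extend (candidate j)| <= (search N).1].
Proof.
elim: N => // N IH0 _; rewrite searchS.
(* The invariant fails for the initial pair, so the induction really starts after the attempt with
   string 0. *)
have IH : (N = 0 /\ search N = (0, set0)) \/
  [/\ minimal_fvs G (~: (search N).2), (search N).1 = #|~: (search N).2|
    & forall j, j < N -> forest (candidate j) ->
      #|~: extend (candidate j)| <= (search N).1].
  by case: N IH0 => [|N'] IH0; [left | right; exact: (IH0 isT)].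
rewrite /attempt; case: ifP => [fN|nfN].
  rewrite /improve; case: IH => [[N0 ->]|[mS cS maxS]].
    rewrite N0 in fN *; split=> //; first exact: extend_minimal.
    by case.
  case: ifP => [le1|/negbT]; last rewrite -ltnNge => lt1.
    split=> //=; first exact: extend_minimal.
    move=> j; rewrite ltnS leq_eqVlt => /orP[/eqP->//|/maxS H /H].
    by move/leq_trans; apply.
  split=> // j; rewrite ltnS leq_eqVlt => /orP[/eqP-> _|]; [exact: ltnW | exact: maxS].
case: IH => [[N0 _]|[mS cS maxS]]; first by rewrite N0 forest_candidate0 in nfN.
split=> // j; rewrite ltnS leq_eqVlt => /orP[/eqP->|]; [by rewrite nfN | exact: maxS].
Qed.

(** Either the strings are long enough to describe [S], or the crossing set is large; then [m] is
    its size, and the three bounds feed the ratio estimate [large_crossing]. *)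
Lemma search_card r S : 0 < r -> minimal_fvs G S ->
  let s := #|~: (search (2 ^ (r * #|C|))).2| in
  #|S| <= s \/
  exists m, [/\ r * #|C| <= #|C| + m, m <= s + #|C| & #|S| <= #|C| + m].
Proof.
move=> r0 mS /=; have N0 : 0 < 2 ^ (r * #|C|) by rewrite expn_gt0.
have [_ <- maxs] := search_minimal N0.
set M := crossing (~: S :&: C).
have SC v : v \notin C -> v \notin ~: S -> v \in M.
  by move=> vC; rewrite inE negbK => vS; apply: minimal_fvs_crossing.
have fS : forest (~: S) by case/minsetP: mS.
case: (leqP (#|C| + #|M|) (r * #|C|)) => [le_r|lt_r].
  left; have [e [Ee le_e _]] := candidate_onto SC.
  rewrite -[S in X in X <= _]setCK -(extend_id mS) -Ee; apply: maxs; last by rewrite Ee.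
  by apply: leq_trans le_e _; rewrite leq_exp2l.
right; exists #|M|; split; [exact: ltnW| |exact: minimal_fvs_card].
(* Dropping [M] makes every outer digit zero, so [#|C|] digits describe [Z], while its trace on [C]
   stays that of [~: S]. *)
set Z := ~: S :\: M.
have ZC : Z :&: C = ~: S :&: C.
  by apply/setP => v; rewrite !inE; case: (v \in C); rewrite ?andbF ?andbT.
have fZ : forest Z by apply: forest_sub fS; apply: subsetDl.
have [v vC vZ|e [Ee _ le_e]] := @candidate_onto Z.
  by rewrite ZC; move: vZ; rewrite in_setD negb_and negbK => /orP[//|]; apply: SC.
have := extend_crossing_card fZ; rewrite ZC => /leq_trans; apply.
rewrite leq_add2r -Ee maxs ?Ee //; apply: leq_trans (le_e _) _.
  rewrite ZC disjoint_sym disjoints_subset; apply/subsetP => v.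
  by rewrite [_ \in ~: _]in_setC in_setD => /andP[].
by rewrite leq_exp2l // leq_pmull.
Qed.

End Candidates.
End Forests.

(** * Time-bounded weakest preconditions *)

Definition wp (s : state) (P : prog) (T : nat) (Q : state -> Prop) :=
  exists t s', [/\ exec P s t s', t <= T & Q s'].

(** Registers from [k] on are scratch space; programs are specified up to their contents. *)
Definition agree k (s s' : state) :=
  cells s = cells s' /\ forall x, x < k -> regs s x = regs s' x.

Lemma agree_trans k s1 s2 s3 : agree k s1 s2 -> agree k s2 s3 -> agree k s1 s3.
Proof.
by rewrite /agree => -[-> r12] [-> r23]; split=> // x xk; rewrite r12 // r23.
Qed.

Lemma agree_weaken k k' s s' : k <= k' -> agree k' s s' -> agree k s s'.
Proof. by move=> kk' [c r]; split=> // x /leq_trans/(_ kk')/r. Qed.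

Lemma agree_set_reg k s s' x v : k <= x -> agree k s s' -> agree k (set_reg s x v) s'.
Proof.
move=> kx [c r]; split=> // y yk; rewrite /= /upd; case: eqP => [E|_]; last exact: r.
by move: yk; rewrite E ltnNge kx.
Qed.

Lemma wp_le s P T T' Q : wp s P T Q -> T <= T' -> wp s P T' Q.
Proof. by move=> [t [s' [? le ?]]] /(leq_trans le); exists t, s'. Qed.

Lemma wp_skip s (Q : state -> Prop) : Q s -> wp s Skip 1 Q.
Proof. by move=> ?; exists 1, s; split=> //; constructor. Qed.

Lemma wp_assign s x e (Q : state -> Prop) :
  Q (set_reg s x (eval s e)) -> wp s (Assign x e) (cost e).+1 Q.
Proof. by move=> ?; do 2 eexists; split; [constructor| |]. Qed.

Lemma wp_store s a e (Q : state -> Prop) :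
  Q (set_cell s (eval s a) (eval s e)) ->
  wp s (Store a e) (cost a + cost e).+1 Q.
Proof. by move=> ?; do 2 eexists; split; [constructor| |]. Qed.

Lemma wp_seq s P1 P2 T1 T2 Q :
  wp s P1 T1 (fun s1 => wp s1 P2 T2 Q) -> wp s (Seq P1 P2) (T1 + T2) Q.
Proof.
move=> [t1 [s1 [e1 le1 [t2 [s2 [e2 le2 q]]]]]].
by exists (t1 + t2), s2; split; [econstructor; eauto|exact: leq_add|].
Qed.

Lemma wp_if s e P1 P2 T Q :
  wp s (if eval s e != 0 then P1 else P2) T Q -> wp s (If e P1 P2) (cost e + T).+1 Q.
Proof.
case: ifP => [e1|/negbFE/eqP e0] [t [s' [ex le q]]]; exists (cost e + t).+1, s';
  by split=> //; [constructor|rewrite ltnS leq_add2l].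
Qed.

(* Register [x.+1] holds [n * regs s x], the offset of row [x] of the adjacency
   matrix, as the machine does not multiply. *)
Definition For x m P :=
  Seq (Assign x (Lit 0)) (Seq (Assign x.+1 (Lit 0))
   (While (Defs.Sub (Reg m) (Reg x))
     (Seq P (Seq (Assign x (Add (Reg x) (Lit 1)))
                 (Assign x.+1 (Add (Reg x.+1) (Reg 0))))))).

(* Programs never depend on the registers from the loop counter upwards, so
   these are left unspecified between two rounds. *)
Lemma wp_for (X : Type) (I : X -> Prop) (f : X -> nat -> X) (st : X -> state)
    x m P T N (X0 : X) n s (Q : state -> Prop) :
    0 < x -> m < x ->
    (forall Y, I Y -> regs (st Y) 0 = n /\ regs (st Y) m = N) ->
    I X0 -> agree x s (st X0) ->
    (forall Y i s, i < N -> I Y -> agree x s (st Y) ->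
       regs s x = i -> regs s x.+1 = i * n ->
       I (f Y i) /\
       wp s P T (fun s' => [/\ agree x s' (st (f Y i)),
                               regs s' x = i & regs s' x.+1 = i * n])) ->
    (forall s', I (foldl f X0 (iota 0 N)) -> agree x s' (st (foldl f X0 (iota 0 N))) -> Q s') ->
  wp s (For x m P) ((T + 20) * N.+1) Q.
Proof.
move=> x0 mx stI IX0 aX0 body post.
(* [k] is the number of rounds left. Besides the body, a round costs 4 for the test and 8 for the
   two assignments; the final test costs 4. *)
suff loop k (Y : X) s1 : k <= N -> I Y -> agree x s1 (st Y) -> regs s1 x = N - k ->
    regs s1 x.+1 = (N - k) * n -> Y = foldl f X0 (iota 0 (N - k)) ->
    wp s1 (While (Defs.Sub (Reg m) (Reg x))
       (Seq P (Seq (Assign x (Add (Reg x) (Lit 1)))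
                 (Assign x.+1 (Add (Reg x.+1) (Reg 0)))))) ((T + 12) * k + 4) Q.
  apply: (@wp_le _ _ (2 + (2 + ((T + 12) * N + 4)))); last by nia.
  apply/wp_seq/wp_assign/wp_seq/wp_assign/loop; rewrite ?subnn //=.
- exact: IX0.
  - by do 2!apply: agree_set_reg => //.
  - by rewrite /upd (ltn_eqF (ltnSn x)) eqxx.
  - by rewrite /upd eqxx.
elim: k Y s1 => [|k IH] Y s1 kN IX aX rx rx1 EX.
  have [E0 Em] := stI Y IX; rewrite subn0 in EX rx rx1.
  exists 4, s1; split; [|by rewrite muln0|by apply: post; rewrite -EX].
  apply: (exec_while_false (e := Defs.Sub (Reg m) (Reg x))).
  by rewrite /= aX.2 // Em rx subnn.
have kN' : N - k.+1 < N by lia.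
have [If [t [s2 [ex2 le2 [a2 r2 r2']]]]] := body Y _ s1 kN' IX aX rx rx1.
have [E0 Em] := stI Y IX; have [E0' _] := stI _ If.
set s3 := set_reg (set_reg s2 x (eval s2 (Add (Reg x) (Lit 1)))) x.+1
  (eval (set_reg s2 x (eval s2 (Add (Reg x) (Lit 1)))) (Add (Reg x.+1) (Reg 0))).
have Ek : N - k = (N - k.+1).+1 by lia.
have [||||||t' [s4 [ex4 le4 q]]] := IH (f Y (N - k.+1)) s3.
- exact: ltnW.
- by [].
- by do 2!apply: agree_set_reg => //.
- by rewrite /= /upd (ltn_eqF (ltnSn x)) eqxx r2 addn1 Ek.
- rewrite /= /upd !eqxx (gtn_eqF (ltnSn x)) (ltn_eqF x0) r2' a2.2 // E0' Ek; lia.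
- by rewrite Ek iotaD1 || rewrite Ek -[in iota _ _]addn1 iotaD foldl_cat -EX.
exists (3 + (t + (4 + 4)) + t').+1, s4; split=> //; last by nia.
apply: (exec_while_true (e := Defs.Sub (Reg m) (Reg x))) ex4.
  by rewrite /= aX.2 // Em rx; lia.
apply: exec_seq ex2 _; apply: (exec_seq (t1 := 4) (t2 := 4)); exact: exec_assign.
Qed.

(** * Memory layout: the adjacency matrix followed by vertex sets as arrays *)

Section Memory.
Variables (n : nat) (G : sgraph 'I_n).
Implicit Types (M : nat -> {set 'I_n}) (s : state) (u v : 'I_n) (A B C F X : {set 'I_n}).

Definition ind A (a : nat) : nat := [exists v in A, val v == a].

Lemma indE A v : ind A v = (v \in A).
Proof.
rewrite /ind; congr nat_of_bool; apply/exists_inP/idP => [[w wA /eqP/val_inj<-//]|vA].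
by exists v.
Qed.

(* Array number [k] occupies the cells from [n * n + k * n] on. *)
Definition memory M (a : nat) : nat :=
  if a < n * n then cells (input G) a
  else ind (M ((a - n * n) %/ n)) ((a - n * n) %% n).

Lemma memory_adj M u v : memory M (u * n + v) = G u v.
Proof.
have lt_uv : u * n + v < n * n.
  have := ltn_ord u; have := ltn_ord v; nia.
rewrite /memory lt_uv /=; congr nat_of_bool.
apply/existsP/idP => [[u' /existsP[v' /andP[/eqP E Guv]]]|Guv].
  have n0 : 0 < n by apply: leq_ltn_trans (ltn_ord u).
  have Eu : u = u'.
    by apply/val_inj; have := congr1 (divn^~ n) E; rewrite /= !divnMDl // !divn_small ?addn0.
  have Ev : v = v' by apply/val_inj; move: E; rewrite Eu => /addnI.
  by rewrite Eu Ev.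
by exists u; apply/existsP; exists v; rewrite eqxx.
Qed.

Definition store_set M k A : nat -> {set 'I_n} := fun k' => if k' == k then A else M k'.

Lemma memory_get M k v : memory M (k * n + n * n + v) = (v \in M k).
Proof.
have n0 : 0 < n by apply: leq_ltn_trans (ltn_ord v).
rewrite /memory ifN; last by rewrite -leqNgt; lia.
have -> : k * n + n * n + v - n * n = k * n + v by lia.
by rewrite divnMDl // divn_small // addn0 modnMDl modn_small // indE.
Qed.

Lemma memory_put M k v (b : bool) :
  upd (memory M) (k * n + n * n + v) b = memory (store_set M k (put b v (M k))).
Proof.
have n0 : 0 < n by apply: leq_ltn_trans (ltn_ord v).
apply/funext => a; rewrite /upd; case: eqP => [->|ne].
  by rewrite memory_get /store_set eqxx in_put eqxx.
rewrite /memory; case: ltnP => // le_a; rewrite /store_set; case: eqP => // Ek.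
rewrite Ek; have lt_m : (a - n * n) %% n < n by rewrite ltn_mod.
rewrite -[(a - n * n) %% n]/(val (Ordinal lt_m)) !indE in_put.
case: eqP => // Ev; case: ne.
rewrite -Ev /= -Ek; have := divn_eq (a - n * n) n; lia.
Qed.

Lemma memory_input : cells (input G) = memory (fun=> set0).
Proof.
apply/funext => a; rewrite /memory; case: ltnP => // le_a.
have -> : ind (set0 : {set 'I_n}) ((a - n * n) %% n) = 0.
  by rewrite /ind; case: exists_inP => // -[w]; rewrite inE.
apply/eqP; rewrite /= eqb0; apply/existsP => -[u /existsP[v /andP[/eqP E _]]].
have := ltn_ord u; have := ltn_ord v; nia.
Qed.

Lemma store_setT M k A B : store_set (store_set M k A) k B = store_set M k B.
Proof. by apply/funext => k'; rewrite /store_set; case: eqP. Qed.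

Lemma store_set_id M k : store_set M k (M k) = M.
Proof. by apply/funext => k'; rewrite /store_set; case: eqP => // ->. Qed.

Lemma wp_forV (X : Type) (I : X -> Prop) (f : X -> 'I_n -> X) (st : X -> state)
    x P T (X0 : X) s (Q : state -> Prop) :
    0 < x ->
    (forall Y, I Y -> regs (st Y) 0 = n) ->
    I X0 -> agree x s (st X0) ->
    (forall Y v s, I Y -> agree x s (st Y) ->
       regs s x = v -> regs s x.+1 = v * n ->
       I (f Y v) /\
       wp s P T (fun s' => [/\ agree x s' (st (f Y v)),
                               regs s' x = v & regs s' x.+1 = v * n])) ->
    (forall s', I (foldl f X0 (enum 'I_n)) ->
                agree x s' (st (foldl f X0 (enum 'I_n))) -> Q s') ->
  wp s (For x 0 P) ((T + 20) * n.+1) Q.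
Proof.
move=> x0 stI IX0 aX0 body post.
(* Extends the step from vertices to all counter values. *)
pose g Y i := if insub i is Some v then f Y v else Y.
have Eg : foldl f X0 (enum 'I_n) = foldl g X0 (iota 0 n).
  rewrite -val_enum_ord; elim: (enum _) X0 {IX0 aX0 post} => //= v l IH X0.
  by rewrite /g valK -/g IH.
rewrite Eg in post.
apply: (wp_for (n := n) (f := g) (I := I) (st := st) x0 x0 _ IX0 aX0) => //.
  by move=> Y /stI.
move=> Y i s1 lt_i IY aY rx rx1; rewrite /g.
by have := body Y (Ordinal lt_i) s1 IY aY rx rx1; rewrite insubT.
Qed.

Definition env s M := [/\ regs s 0 = n, regs s 1 = n * n & cells s = memory M].

Lemma env_agree k s s' M : 1 < k -> agree k s s' -> env s' M -> env s M.
Proof.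
by move=> k1 [c r] [r0 r1 cM]; split; rewrite ?c ?r //; apply: ltnW.
Qed.

(** The product [k * n] is unfolded into additions; [k] is fixed in the program text, so the cost
    does not depend on the input. *)
Fixpoint base k := if k is k'.+1 then Add (Reg 0) (base k') else Reg 1.
Definition get k x := Fetch (Add (base k) (Reg x)).
Definition Put k x e := Store (Add (base k) (Reg x)) e.
(** Here [x] is a loop counter, whose row offset [For] keeps in [x.+1]. *)
Definition edge x y := Fetch (Add (Reg x.+1) (Reg y)).

Lemma cost_base k : cost (base k) = k.*2.+1.
Proof. by elim: k => //= k ->; rewrite add1n. Qed.

Lemma eval_base s k : regs s 0 = n -> regs s 1 = n * n -> eval s (base k) = k * n + n * n.
Proof. by move=> r0 r1; elim: k => //= k ->; rewrite r0 mulSn addnA. Qed.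

Lemma eval_get_cell s k x :
  regs s 0 = n -> regs s 1 = n * n -> eval s (get k x) = cells s (k * n + n * n + regs s x).
Proof. by move=> r0 r1 /=; rewrite eval_base. Qed.

Lemma eval_get s M k x v : env s M -> regs s x = v -> eval s (get k x) = (v \in M k).
Proof. by case=> r0 r1 cM rx; rewrite eval_get_cell // rx cM memory_get. Qed.

Lemma eval_edge s M x y u v :
  env s M -> regs s x.+1 = u * n -> regs s y = v -> eval s (edge x y) = G u v.
Proof. by move=> [_ _ cM] /= -> ->; rewrite cM memory_adj. Qed.

Lemma wp_put s M k x e v (b : bool) (Q : state -> Prop) :
    env s M -> regs s x = v -> eval s e = b ->
    Q (State (regs s) (memory (store_set M k (put b v (M k))))) ->
  wp s (Put k x e) (k.*2 + 4 + cost e) Q.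
Proof.
move=> es rx ev q.
have -> : k.*2 + 4 + cost e = (cost (Add (base k) (Reg x)) + cost e).+1.
  by rewrite /= cost_base; lia.
case: es => r0 r1 cM; apply: wp_store; rewrite ev /= eval_base // rx.
by rewrite /set_cell cM memory_put.
Qed.

Lemma cost_edge x y : cost (edge x y) = 4. Proof. by []. Qed.

Lemma cost_get k x : cost (get k x) = k.*2 + 4.
Proof. by rewrite /= cost_base; lia. Qed.

End Memory.

Opaque get edge.
Arguments upd _ _ _ _ /.

(** * The programs, their correctness and their running times *)

Section Programs.
Variables (n : nat) (G : sgraph 'I_n).
Implicit Types (M : nat -> {set 'I_n}) (s : state) (u v : 'I_n) (A B C F X : {set 'I_n}).
Local Notation memory := (memory G).
Local Notation env := (env G).

(* Arrays: 0 is the vertex cover, 1 the current candidate, 2 is scratch space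
   for peeling, 3 holds the best forest found so far and 4 stays empty.
   Registers: 1 is [n * n], 2 the number of digits, 3 the number of digit
   strings, 4 the size of the best feedback vertex set, 5 the current digit
   string and 7 its digits not yet read. *)
Definition Count k x c y :=
  Seq (Assign c (Lit 0))
    (For y 0 (Assign c (Add (Reg c) (Defs.Sub (edge x y) (Defs.Sub (Lit 1) (get k y)))))).

Lemma foldl_add (T : Type) (f : T -> nat) m l :
  foldl (fun a i => a + f i) m l = m + \sum_(i <- l) f i.
Proof.
by elim: l m => [|i l IH] m /=; rewrite ?big_nil ?addn0 // IH big_cons addnA.
Qed.

Lemma foldl_add_card (P : pred 'I_n) A :
  (forall v, P v = (v \in A)) -> foldl (fun a v => a + P v) 0 (enum 'I_n) = #|A|.
Proof.
move=> PA; rewrite foldl_add add0n -sum1_card big_enum /= [RHS]big_mkcond.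
by apply: eq_bigr => v _; rewrite PA; case: ifP.
Qed.

Lemma wp_count s M k x c y v (Q : state -> Prop) :
    k < 5 -> 1 < c -> x.+1 < c -> c < y -> env s M -> regs s x.+1 = v * n ->
    (forall s', agree y s' (set_reg s c (deg G (M k) v)) -> Q s') ->
  wp s (Count k x c y) (50 * n.+1) Q.
Proof.
move=> k5 c1 xc cy es rx post.
apply: (@wp_le _ _ (2 + (22 + 20) * n.+1)); last by lia.
apply/wp_seq/wp_assign.
(* On bits, [p - (1 - q)] is the conjunction of [p] and [q]. *)
pose f a u := a + (G v u && (u \in M k)).
have Efold : foldl f 0 (enum 'I_n) = deg G (M k) v.
  by apply: foldl_add_card => u; rewrite inE andbC.
apply: (wp_forV (f := f) (I := fun=> True) (st := fun a => set_reg s c a) (X0 := 0)) => //.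
- lia.
- by move=> a _; rewrite /= /upd; case: es => r0 _ _; case: eqP => //; lia.
- move=> a u s1 _ a1 ry ry1; split=> //.
  have e1 : env s1 M.
    apply: env_agree a1 _; first lia.
    by case: es => r0 r1 cM; split; rewrite //= /upd; case: eqP => //; lia.
  have rx1 : regs s1 x.+1 = v * n.
    by rewrite a1.2 /= /upd; [case: eqP => //; lia | lia].
  apply: (@wp_le _ _ (cost (Add (Reg c) (Defs.Sub (edge x y) (Defs.Sub (Lit 1) (get k y))))).+1).
    apply: wp_assign; split; rewrite /= /upd.
    + rewrite (eval_edge e1 rx1 ry) (eval_get k e1 ry) a1.2 // /= /upd eqxx /f.
      split; first exact: a1.1.
      move=> z zy /=; rewrite /upd; case: eqP => [_|ne]; last first.
        by rewrite a1.2 //= /upd; case: eqP.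
      by case: (G v u); case: (u \in M k).
    + by case: eqP => //; lia.
    + by case: eqP => //; lia.
  by rewrite /= cost_get cost_edge; lia.
by move=> s' _; rewrite Efold; apply: post.
Qed.

Definition Copy k1 k2 x := For x 0 (Put k2 x (get k1 x)).

Lemma wp_copy s M k1 k2 x (Q : state -> Prop) :
    k1 < 5 -> k2 < 5 -> k1 != k2 -> 1 < x -> env s M ->
    (forall s', agree x s' (State (regs s) (memory (store_set M k2 (M k1)))) -> Q s') ->
  wp s (Copy k1 k2 x) (50 * n.+1) Q.
Proof.
move=> k15 k25 k12 x1 es post; case: (es) => r0 r1 cM.
pose f A v := put (v \in M k1) v A.
have Efold : foldl f (M k2) (enum 'I_n) = M k1.
  suff H l A : foldl f A l = [set w | if w \in l then w \in M k1 else w \in A].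
    by rewrite H; apply/setP => w; rewrite inE mem_enum.
  elim: l A => [|v l IH] A /=; first by apply/setP => w; rewrite inE.
  rewrite IH; apply/setP => w; rewrite !inE in_put.
  by case: (w \in l); rewrite ?orbT ?orbF //; case: eqVneq => // ->.
apply: (@wp_le _ _ ((24 + 20) * n.+1)); last by lia.
apply: (wp_forV (f := f) (I := fun=> True) (X0 := M k2)
  (st := fun A => State (regs s) (memory (store_set M k2 A)))) => //; first lia.
- by rewrite store_set_id -cM; case: (s).
- move=> A v s1 _ a1 rx rx1; split=> //.
  have e1 : env s1 (store_set M k2 A) by apply: env_agree a1 _; [lia|split].
  apply: (@wp_le _ _ (k2.*2 + 4 + cost (get k1 x))); last by rewrite cost_get; lia.
  apply: (wp_put e1 rx (eval_get k1 e1 rx)); split=> //=.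
  rewrite store_setT /store_set eqxx (negbTE k12).
  by split=> //= y yx; rewrite a1.2.
by move=> s' _; rewrite Efold; apply: post.
Qed.

(** The test, degree minus one, is nonzero exactly for degree at least two. Inner loops use higher
    registers than the loops around them. *)
Definition PeelRound :=
  For 24 0 (Seq (Count 2 24 26 28) (If (Defs.Sub (Reg 26) (Lit 1)) Skip (Put 2 24 (Lit 0)))).

Lemma wp_peel_round s M (Q : state -> Prop) :
    env s M ->
    (forall s', agree 24 s' (State (regs s) (memory (store_set M 2 (peel_round G (M 2))))) -> Q s') ->
  wp s PeelRound (100 * n.+1 * n.+1) Q.
Proof.
move=> [r0 r1 cM] post.
apply: (@wp_le _ _ ((70 * n.+1 + 20) * n.+1)); last by nia.
apply: (wp_forV (f := peel1 G) (I := fun=> True) (X0 := M 2)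
  (st := fun A => State (regs s) (memory (store_set M 2 A)))) => //.
- by rewrite store_set_id -cM; case: (s).
- move=> A v s1 _ a1 rx rx1; split=> //.
  have e1 : env s1 (store_set M 2 A) by apply: env_agree a1 _; [|split].
  apply: (@wp_le _ _ (50 * n.+1 + (3 + 16).+1)); last by lia.
  apply/wp_seq/(wp_count _ _ _ _ e1 rx1) => // s2 a2.
  have e2 : env s2 (store_set M 2 A).
    by apply: (env_agree (k := 28) _ a2) => //; case: e1.
  apply: wp_if; rewrite /= a2.2 //= subn_eq0 if_neg.
  have rx2 : regs s2 24 = v by rewrite a2.2.
  have rx3 : regs s2 25 = v * n by rewrite a2.2.
  have r12 z : z < 24 -> regs s2 z = regs s z.
    move=> lt_z; rewrite a2.2 /=; last by lia.
    by rewrite ifN ?a1.2 // ltn_eqF //; lia.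
  rewrite /peel1 {2}/store_set /=; case: ifP => d1.
    apply: (@wp_le _ _ (2.*2 + 4 + 1)) => //.
    apply: (wp_put (b := false) e2 rx2) => //; split=> //.
    by rewrite store_setT; split.
  apply: wp_le (wp_skip _) _ => //; split=> //; split=> //.
  by case: e2.
by move=> s' _; apply: post.
Qed.

Lemma foldl_iter (S T : Type) (f : T -> T) a (l : seq S) :
  foldl (fun b _ => f b) a l = iter (size l) f a.
Proof. by elim: l a => //= i l IH a; rewrite IH -iterSr. Qed.

(* Leaves in register 20 the number of vertices on which peeling array 1 gets stuck. *)
Definition Check :=
  Seq (Copy 1 2 22) (Seq (For 22 0 PeelRound)
 (Seq (Assign 20 (Lit 0)) (Seq (For 22 0 (Assign 20 (Add (Reg 20) (get 2 22))))
      (Copy 4 2 22)))).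

Lemma wp_check s M (Q : state -> Prop) :
    env s M -> M 2 = set0 -> M 4 = set0 ->
    (forall s', agree 21 s' (set_reg s 20 #|peel G (M 1)|) -> Q s') ->
  wp s Check (300 * n.+1 * n.+1 * n.+1) Q.
Proof.
move=> e0 M2 M4 post; have [r0 r1 cM] := e0.
apply: (@wp_le _ _ (50 * n.+1 + ((100 * n.+1 * n.+1 + 20) * n.+1 +
  (2 + ((20 + 20) * n.+1 + 50 * n.+1))))); last first.
  have : 0 < n.+1 by []; move: n.+1 => u u0; have : u <= u * u by nia.
  have : u * u <= u * u * u by nia.
  nia.
apply/wp_seq/(wp_copy _ _ _ _ e0) => // s1 a1; apply: wp_seq.
apply: (wp_for (f := fun (A : {set 'I_n}) _ => peel_round G A) (I := fun=> True) (X0 := M 1) (n := n) (N := n)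
  (st := fun A => State (regs s) (memory (store_set M 2 A)))) => //.
- move=> A i s2 _ _ a2 rx rx1; split=> //.
  have e2 : env s2 (store_set M 2 A) by apply: env_agree a2 _; [|split].
  apply: (wp_peel_round e2) => s3 a3; split; try by rewrite a3.2.
  apply: agree_trans (agree_weaken _ a3) _ => //.
  by rewrite store_setT; split=> //= z z22; rewrite a2.2.
move=> s2 _; have -> : foldl (fun A _ => peel_round G A) (M 1) (iota 0 n) = peel G (M 1).
  by rewrite foldl_iter size_iota /peel card_ord.
set P := peel G (M 1) => a2.
have e2 : env s2 (store_set M 2 P) by apply: env_agree a2 _; [|split].
apply/wp_seq/wp_assign/wp_seq.
apply: (wp_forV (f := fun a v => a + (v \in P)) (I := fun=> True) (X0 := 0)
  (st := fun a => set_reg s2 20 a)) => //.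
- by move=> a _ /=; case: e2.
- move=> a v s3 _ a3 rx rx1; split=> //.
  have e3 : env s3 (store_set M 2 P).
    by apply: (env_agree _ a3) => //; case: e2.
  apply: (@wp_le _ _ (cost (Add (Reg 20) (get 2 22))).+1); last by rewrite /= cost_get.
  apply: wp_assign; rewrite /= (eval_get 2 e3 rx) a3.2 //=.
  split=> //; split=> /=; first exact: a3.1.
  by move=> z z22; case: eqP => // ne; rewrite a3.2 //=; case: eqP.
rewrite (@foldl_add_card _ P) // => s3 _ a3.
have e3 : env s3 (store_set M 2 P) by apply: (env_agree _ a3) => //; case: e2.
apply: (wp_copy _ _ _ _ e3) => // s4 a4; apply: post.
apply: agree_trans (agree_weaken _ a4) _ => //.
(* Copying the empty array 4 has reset the scratch array, so the memory is as before the call. *)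
rewrite store_setT /store_set /= M4 -M2 -/(store_set M 2 (M 2)) store_set_id -cM.
split=> //= z z21; rewrite a3.2 /=; last by lia.
by case: eqP => // _; rewrite a2.2 //=; lia.
Qed.

(** Halving by counting: in each of [d] rounds the half grows by the parity bit, which then flips.
    This is linear in the value [d], hence in the number of digit strings. *)
Definition Half :=
  Seq (Assign 12 (Lit 0)) (Seq (Assign 13 (Lit 0))
  (Seq (For 14 7 (Seq (Assign 12 (Add (Reg 12) (Reg 13))) (Assign 13 (Defs.Sub (Lit 1) (Reg 13)))))
       (Assign 7 (Reg 12)))).

Lemma wp_half s d m (Q : state -> Prop) :
    regs s 0 = m -> regs s 7 = d ->
    (forall s', agree 14 s' (State (upd (upd (upd (regs s) 12 d./2) 13 (odd d)) 7 d./2) (cells s)) -> Q s') ->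
  wp s Half (40 * d.+1) Q.
Proof.
move=> r0 r7 post.
apply: (@wp_le _ _ (2 + (2 + ((8 + 20) * d.+1 + 2)))); last by lia.
apply/wp_seq/wp_assign/wp_seq/wp_assign/wp_seq.
apply: (wp_for (f := fun hb _ => (hb.1 + hb.2, 1 - hb.2)) (I := fun=> True) (X0 := (0, 0)) (n := m) (N := d)
  (st := fun hb => State (upd (upd (regs s) 12 hb.1) 13 hb.2) (cells s))) => //.
- move=> [h b] i s1 _ _ a1 rx rx1; split=> //.
  apply: (@wp_le _ _ (4 + 4)) => //.
  apply/wp_seq/wp_assign/wp_assign; split=> //=; split=> /=; first exact: a1.1.
  by move=> z lt_z; rewrite !a1.2 //=; case: eqP => // _; case: eqP.
have -> : foldl (fun hb _ => (hb.1 + hb.2, 1 - hb.2)) (0, 0) (iota 0 d) = (d./2, odd d : nat).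
  elim: (d) => // k IH; rewrite -[k.+1]addn1 iotaD foldl_cat IH /= addn1 /= uphalf_half addnC.
  by case: odd.
move=> s1 _ a1; apply: wp_assign; apply: post; split=> /=; first exact: a1.1.
by move=> z lt_z; rewrite !a1.2.
Qed.

Definition ReadDigit := Seq Half (Put 1 10 (Reg 13)).

Lemma wp_read_digit s M d v (Q : state -> Prop) :
    env s M -> regs s 7 = d -> regs s 10 = v ->
    (forall s', agree 12 s' (State (upd (regs s) 7 d./2)
                  (memory (store_set M 1 (put (odd d) v (M 1))))) -> Q s') ->
  wp s ReadDigit (60 * d.+1) Q.
Proof.
move=> e0 r7 r10 post; have [r0 r1 cM] := e0.
apply: (@wp_le _ _ (40 * d.+1 + (1.*2 + 4 + 1))); last by lia.
apply/wp_seq/(wp_half r0 r7) => s1 a1.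
have e1 : env s1 M by apply: (env_agree _ a1).
apply: (wp_put (b := odd d) (v := v) e1); rewrite /= ?a1.2 //=.
apply: post; split=> //= z lt_z; rewrite a1.2 /=; last by lia.
by case: eqP => // _; rewrite !ifN //; lia.
Qed.

Definition ReadCover := For 10 0 (If (get 0 10) ReadDigit Skip).

(** The unread digits only shrink, so they stay below [w]; this bounds every halving and is handed
    on to the second pass. *)
Lemma wp_read_cover s M d w (Q : state -> Prop) :
    env s M -> regs s 7 = d -> d < w ->
    let r := foldl (read (in_cover (M 0)) (fun F v => v \in F)) (d, M 1) (enum 'I_n) in
    (forall s', r.1 < w -> agree 10 s' (State (upd (regs s) 7 r.1) (memory (store_set M 1 r.2))) -> Q s') ->
  wp s ReadCover (100 * w * n.+1) Q.
Proof.
move=> e0 r7 dw r post; have [r0 r1 cM] := e0.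
apply: (@wp_le _ _ ((60 * w + 6 + 20) * n.+1)); last by rewrite leq_mul2r; lia.
apply: (wp_forV (f := read (in_cover (M 0)) (fun F v => v \in F)) (I := fun dF => dF.1 < w) (X0 := (d, M 1))
  (st := fun dF => State (upd (regs s) 7 dF.1) (memory (store_set M 1 dF.2)))) => //.
- by split=> /=; [rewrite store_set_id | move=> z _; case: eqP => // ->].
- move=> [k F] v s1 /= kw a1 rx rx1.
  have e1 : env s1 (store_set M 1 F) by apply: (env_agree _ a1).
  split; first by rewrite /read /=; case: ifP => //= _; lia.
  apply: (@wp_le _ _ (4 + 60 * w).+1); last by lia.
  apply: (wp_if (e := get 0 10)); rewrite (eval_get 0 e1 rx) /read /in_cover /=.
  rewrite {1}/store_set /= eqb0 negbK; case: ifP => vC.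
    apply: (@wp_le _ _ (60 * k.+1)); last by lia.
    apply: (wp_read_digit (v := v) e1) => //; first by rewrite a1.2.
    move=> s2 a2; rewrite store_setT /store_set /= in a2.
    split; rewrite ?a2.2 //=.
    split=> /=; first exact: a2.1.
    move=> z lt_z; rewrite a2.2 /=; last by lia.
    by case: eqP => // ne; rewrite a1.2 //=; case: eqP.
  by apply: wp_le (wp_skip _) _; rewrite ?put_id ?muln_gt0 //; lia.
Qed.

Definition ReadRest :=
  For 10 0 (If (get 0 10) Skip
    (Seq (Count 1 10 12 14)
      (If (Defs.Sub (Reg 12) (Lit 1)) ReadDigit (Put 1 10 (Lit 1))))).

Lemma wp_read_rest s M d w (Q : state -> Prop) :
    env s M -> regs s 7 = d -> d < w ->
    let r := foldl (read (branching G (M 0)) (free (M 0))) (d, M 1) (enum 'I_n) in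
    (forall s', agree 10 s' (State (upd (regs s) 7 r.1) (memory (store_set M 1 r.2))) -> Q s') ->
  wp s ReadRest (200 * w * n.+1 * n.+1) Q.
Proof.
move=> e0 r7 dw r post; have [r0 r1 cM] := e0.
have w0 : 0 < w by apply: leq_ltn_trans dw.
apply: (@wp_le _ _ ((50 * n.+1 + 60 * w + 30 + 20) * n.+1)); last by nia.
apply: (wp_forV (f := read (branching G (M 0)) (free (M 0))) (I := fun dF => dF.1 < w) (X0 := (d, M 1))
  (st := fun dF => State (upd (regs s) 7 dF.1) (memory (store_set M 1 dF.2)))) => //.
- by split=> /=; [rewrite store_set_id | move=> z _; case: eqP => // ->].
- move=> [k F] v s1 /= kw a1 rx rx1.
  have e1 : env s1 (store_set M 1 F) by apply: (env_agree _ a1).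
  split; first by rewrite /read /=; case: ifP => //= _; lia.
  apply: (@wp_le _ _ (4 + (50 * n.+1 + (3 + (60 * w + 7)).+1)).+1); last by lia.
  apply: (wp_if (e := get 0 10)); rewrite (eval_get 0 e1 rx) /read /branching /free /=.
  rewrite {1}/store_set /= eqb0 negbK; case: ifP => vC /=.
    by apply: wp_le (wp_skip _) _; rewrite ?put_id.
  apply/wp_seq/(wp_count _ _ _ _ e1 rx1) => // s2 a2.
  have e2 : env s2 (store_set M 1 F) by apply: (env_agree (k := 14) _ a2) => //; case: e1.
  have r2 : regs s2 10 = v by rewrite a2.2.
  have r12 z : z < 12 -> regs s2 z = regs s1 z.
    by move=> lt_z; rewrite a2.2 /= ?ifN //; lia.
  apply: wp_if; rewrite /= a2.2 //= subn_eq0 -ltnNge {1}/store_set /=; case: ifP => dv.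
    apply: (@wp_le _ _ (60 * k.+1)); last by lia.
    apply: (wp_read_digit (v := v) e2) => //; first by rewrite r12 // a1.2.
    move=> s3 a3; rewrite store_setT /store_set /= in a3.
    have r211 : regs s2 11 = v * n by rewrite a2.2.
    split; rewrite ?a3.2 //=.
    split=> /=; first exact: a3.1.
    move=> z lt_z; rewrite a3.2 /=; last by lia.
    by case: eqP => // ne; rewrite r12 ?a1.2 //=; [case: eqP | lia].
  apply: (@wp_le _ _ (1.*2 + 4 + 1)); last by lia.
  apply: (wp_put (b := true) e2 r2) => //; rewrite store_setT /store_set /=.
  by split; rewrite /= ?r12 //; split=> //= z lt_z; rewrite r12 ?a1.2 //; lia.
by move=> s1 _; apply: post.
Qed.

Definition Extend :=
  For 10 0 (Seq (Put 1 10 (Lit 1)) (Seq Check (If (Reg 20) (Put 1 10 (Lit 0)) Skip))).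

Lemma wp_extend s M (Q : state -> Prop) :
    env s M -> M 2 = set0 -> M 4 = set0 -> forest G (M 1) ->
    (forall s', agree 10 s' (State (regs s) (memory (store_set M 1 (extend G (M 1))))) -> Q s') ->
  wp s Extend (400 * n.+1 * n.+1 * n.+1 * n.+1) Q.
Proof.
move=> e0 M2 M4 fF post; have [r0 r1 cM] := e0.
apply: (@wp_le _ _ ((30 + 300 * n.+1 * n.+1 * n.+1 + 20) * n.+1)); last first.
  rewrite leq_mul2r; apply/orP; right.
  have : 0 < n.+1 * n.+1 * n.+1 by rewrite !muln_gt0.
  by rewrite -!mulnA; move: (n.+1 * _) => u; lia.
apply: (wp_forV (f := grow G) (I := forest G) (X0 := M 1)
  (st := fun F => State (regs s) (memory (store_set M 1 F)))) => //.
- by rewrite store_set_id -cM; case: (s).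
- move=> F v s1 fF1 a1 rx rx1; split; first by rewrite /grow; case: ifP.
  have e1 : env s1 (store_set M 1 F) by apply: (env_agree _ a1).
  apply: (@wp_le _ _ (7 + (300 * n.+1 * n.+1 * n.+1 + (1 + 7).+1))); last by lia.
  apply: wp_seq; apply: (wp_put (b := true) e1 rx) => //; rewrite store_setT.
  set s2 := State _ _.
  have e2 : env s2 (store_set M 1 (v |: F)) by case: e1.
  apply/wp_seq/(wp_check e2) => // s3 a3.
  have e3 : env s3 (store_set M 1 (v |: F)) by apply: (env_agree (k := 21) _ a3) => //; case: e1.
  have r3 : regs s3 10 = v by rewrite a3.2.
  have r13 z : z < 12 -> regs s3 z = regs s1 z.
    by move=> lt_z; rewrite a3.2 /= ?ifN //; lia.
  apply: wp_if; rewrite /= a3.2 //= cards_eq0 peel_eq0 if_neg /grow; case: ifP => fv.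
    apply: wp_le (wp_skip _) _ => //; rewrite !r13 //; split=> //; split=> /=; first exact: a3.1.
    by move=> z lt_z; rewrite r13 ?a1.2 //; lia.
  apply: (@wp_le _ _ (1.*2 + 4 + 1)) => //.
  (* Undoing the insertion restores [F]: had [v] been in [F] already, [v |: F] would be the forest
     [F]. *)
  have vF : put false v (store_set M 1 (v |: F) 1) = F.
    rewrite /put [store_set _ _ _ 1]/store_set /= setU1K //; apply: contraFN fv => vF.
    by rewrite (setUidPr _) ?sub1set.
  apply: (wp_put (b := false) e3 r3) => //; rewrite vF store_setT /= !r13 //; split=> //.
  by split=> //= z lt_z; rewrite r13 ?a1.2 //; lia.
by move=> s1 _; apply: post.
Qed.

(** With truncated subtraction, [a + 1 - b] is nonzero iff [b <= a], the comparison made by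
    [improve]. *)
Definition Improve :=
  Seq (Assign 10 (Lit 0))
 (Seq (For 12 0 (Assign 10 (Add (Reg 10) (Defs.Sub (Lit 1) (get 1 12)))))
      (If (Defs.Sub (Add (Reg 10) (Lit 1)) (Reg 4))
          (Seq (Assign 4 (Reg 10)) (Copy 1 3 12)) Skip)).

Lemma wp_improve s M (Q : state -> Prop) :
    env s M ->
    let r := improve (regs s 4, M 3) (M 1) in
    (forall s', agree 10 s' (State (upd (regs s) 4 r.1) (memory (store_set M 3 r.2))) -> Q s') ->
  wp s Improve (150 * n.+1) Q.
Proof.
move=> e0 r post; have [r0 r1 cM] := e0.
apply: (@wp_le _ _ (2 + ((20 + 20) * n.+1 + (5 + (2 + 50 * n.+1)).+1))); last by lia.
apply/wp_seq/wp_assign/wp_seq.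
apply: (wp_forV (f := fun a v => a + (v \in ~: M 1)) (I := fun=> True) (X0 := 0)
  (st := fun a => set_reg s 10 a)) => //.
- move=> a v s1 _ a1 rx rx1; split=> //.
  have e1 : env s1 M by apply: (env_agree _ a1).
  apply: (@wp_le _ _ (cost (Add (Reg 10) (Defs.Sub (Lit 1) (get 1 12)))).+1); last by rewrite /= cost_get.
  apply: wp_assign; rewrite /= (eval_get 1 e1 rx) a1.2 //= in_setC.
  split=> //; split=> /=; first exact: a1.1.
  move=> z lt_z; case: eqP => // [_|ne]; first by case: (v \in M 1).
  by rewrite a1.2 //=; case: eqP.
rewrite (@foldl_add_card _ (~: M 1)) // => s1 _ a1.
have e1 : env s1 M by apply: (env_agree _ a1).
have r14 : regs s1 4 = regs s 4 by rewrite a1.2.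
have r110 : regs s1 10 = #|~: M 1| by rewrite a1.2.
apply: wp_if; rewrite /= r14 r110 subn_eq0 -ltnNge addn1 ltnS.
rewrite /r /improve /= in post; case: ifP post => le post.
  apply/wp_seq/wp_assign; rewrite /= r110.
  have e2 : env (set_reg s1 4 #|~: M 1|) M by case: e1.
  apply: (wp_copy _ _ _ _ e2) => //.
  move=> s2 a2; apply: post; apply: agree_trans (agree_weaken _ a2) _ => //.
  split=> //= z lt_z; case: eqP => // ne; rewrite a1.2 /=; last by lia.
  by rewrite ifN //; lia.
apply: wp_le (wp_skip _) _ => //; apply: post; rewrite store_set_id.
split=> /=; first by rewrite a1.1.
move=> z lt_z; rewrite a1.2 /=; last by lia.
by case: eqP => [?|_]; [lia | case: eqP => // ->].
Qed.

(** Array 1 is emptied at the end because every candidate is read starting from the empty set. *)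
Definition Try :=
  Seq (Assign 7 (Reg 5)) (Seq ReadCover (Seq ReadRest (Seq Check
 (Seq (If (Reg 20) Skip (Seq Extend Improve)) (Copy 4 1 10))))).

Lemma wp_try s M w (Q : state -> Prop) :
    env s M -> M 1 = set0 -> M 2 = set0 -> M 4 = set0 -> regs s 5 < w ->
    let r := attempt G (M 0) (regs s 4, M 3) (regs s 5) in
    (forall s', agree 7 s' (State (upd (regs s) 4 r.1) (memory (store_set M 3 r.2))) -> Q s') ->
  wp s Try (2000 * (n.+1 * n.+1 * n.+1 * n.+1) * w) Q.
Proof.
move=> e0 M1 M2 M4 jw r post; have [r0 r1 cM] := e0.
have w0 : 0 < w by apply: leq_ltn_trans jw.
apply: (@wp_le _ _ (2 + (100 * w * n.+1 + (200 * w * n.+1 * n.+1 + (300 * n.+1 * n.+1 * n.+1 +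
   ((1 + (400 * n.+1 * n.+1 * n.+1 * n.+1 + 150 * n.+1)).+1 + 50 * n.+1)))))); last first.
  have : 0 < n.+1 by []; move: n.+1 => u u0.
  have h2 : u * u <= u * u * u * u by rewrite -mulnA leq_pmulr // muln_gt0 u0.
  have h1 : u <= u * u * u * u by apply: leq_trans h2; rewrite leq_pmulr.
  have h3 : u * u * u <= u * u * u * u by rewrite leq_pmulr.
  have h0 : 0 < u * u * u * u by apply: leq_trans h1.
  have h4 := leq_pmulr (u * u * u * u) w0.
  have h5 : w * u <= u * u * u * u * w by rewrite mulnC leq_mul2r h1 orbT.
  have h6 : w * u * u <= u * u * u * u * w by rewrite -mulnA mulnC leq_mul2r h2 orbT.
  have E1 : 100 * w * u = 100 * (w * u) by rewrite mulnA.
  have E2 : 200 * w * u * u = 200 * (w * u * u) by rewrite !mulnA.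
  have E3 : 300 * u * u * u = 300 * (u * u * u) by rewrite !mulnA.
  have E4 : 400 * u * u * u * u = 400 * (u * u * u * u) by rewrite !mulnA.
  rewrite E1 E2 E3 E4 -[2000 * _ * w]mulnA {E1 E2 E3 E4}.
  move: (w * u) (w * u * u) (u * u * u) h3 h4 h5 h6 h0 h1 => x1 x2 x3.
  move: (u * u * u * u * w) (u * u * u * u) => x4 x5; lia.
apply/wp_seq/wp_assign/wp_seq; rewrite /=.
apply: (wp_read_cover (M := M) _ _ jw) => //= s1 lt1 a1.
apply: wp_seq; move: lt1 a1; set d1 := _.1; set F1 := _.2 => lt1 a1.
have e1 : env s1 (store_set M 1 F1) by apply: (env_agree _ a1).
apply: (wp_read_rest e1 _ lt1); first by rewrite a1.2.
rewrite store_setT [store_set _ _ _ 0]/store_set /= [store_set _ _ _ 1]/store_set /= => s2.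
rewrite -[(d1, F1)]surjective_pairing M1 -/(candidate G (M 0) (regs s 5)).
set F := candidate _ _ _ => a2.
have e2 : env s2 (store_set M 1 F) by apply: (env_agree _ a2) => //; case: e1.
have r2 z : z < 7 -> regs s2 z = regs s z.
  move=> lt_z; rewrite a2.2 /=; last by lia.
  by rewrite ifN ?a1.2 /= ?ifN //; lia.
apply/wp_seq/(wp_check e2) => // s3 a3.
have e3 : env s3 (store_set M 1 F) by apply: (env_agree _ a3) => //; case: e2.
have r3 z : z < 7 -> regs s3 z = regs s z.
  by move=> lt_z; rewrite a3.2 /= ?ifN ?r2 //; lia.
(* The contents of array 1 before it is cleared, which lets both branches share the final copy. *)
pose X := if forest G F then extend G F else F.
suff fin s4 : agree 7 s4 (State (upd (regs s) 4 r.1) (memory (store_set (store_set M 1 X) 3 r.2))) ->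
  wp s4 (Copy 4 1 10) (50 * n.+1) Q.
  apply/wp_seq/wp_if; rewrite /= a3.2 //= cards_eq0 peel_eq0 if_neg [store_set _ _ _ 1]/store_set /=.
  rewrite /r /attempt -/F /X in fin; case: ifP fin => fF fin.
    apply/wp_seq/(wp_extend e3) => // s5 a5; rewrite store_setT [store_set _ _ _ 1]/store_set /= in a5.
    have e5 : env s5 (store_set M 1 (extend G F)) by apply: (env_agree _ a5) => //; case: e3.
    have r5 z : z < 7 -> regs s5 z = regs s z.
      by move=> lt_z; rewrite a5.2 /= ?r3 //; lia.
    apply: (wp_improve e5); rewrite r5 // /store_set /= => s6 a6.
    apply: fin; apply: agree_trans (agree_weaken _ a6) _ => //.
    by split=> //= z lt_z; case: eqP => // _; rewrite r5.
  apply: wp_le (wp_skip _) _ => //; apply: fin; split=> /=.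
    rewrite a3.1 a2.1 /=; congr memory; apply/funext => k; rewrite /store_set.
    by case: (eqVneq k 3) => // ->.
  by move=> z lt_z; rewrite r3 //; case: eqP => // ->.
move=> a4; have e4 : env s4 (store_set (store_set M 1 X) 3 r.2) by apply: (env_agree _ a4).
apply: (wp_copy _ _ _ _ e4) => // s5 a5; apply: post.
apply: agree_trans (agree_weaken _ a5) _ => //; split=> /=; last exact: a4.2.
congr memory; apply/funext => k; rewrite /store_set /= M4.
by case: (eqVneq k 1) => // ->.
Qed.

(** The test is nonzero exactly for an edge with both ends still outside the cover. *)
Definition FindCover :=
  For 8 0 (For 10 0
    (If (Defs.Sub (edge 8 10) (Add (get 0 8) (get 0 10)))
        (Seq (Put 0 8 (Lit 1)) (Put 0 10 (Lit 1))) Skip)).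

Lemma wp_find_cover s M (Q : state -> Prop) :
    env s M -> M 0 = set0 ->
    (forall s', agree 8 s' (State (regs s) (memory (store_set M 0 (greedy_cover G)))) -> Q s') ->
  wp s FindCover (100 * n.+1 * n.+1) Q.
Proof.
move=> [r0 r1 cM] M0 post.
apply: (@wp_le _ _ (((25 + 20) * n.+1 + 20) * n.+1)); last by nia.
apply: (wp_forV (f := cover_row G) (I := fun=> True) (X0 := set0)
  (st := fun A => State (regs s) (memory (store_set M 0 A)))) => //.
- by rewrite -M0 store_set_id -cM; case: (s).
- move=> C u s1 _ a1 ru ru1; split=> //.
  apply: (wp_forV (f := fun A => cover_pair G A u) (I := fun=> True) (X0 := C)
    (st := fun A => State (regs s1) (memory (store_set M 0 A)))) => //.
  + by move=> Y _; rewrite /= a1.2.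
  + by split=> //; exact: a1.1.
  + move=> A v s2 _ a2 rv rv1; split=> //.
    have e2 : env s2 (store_set M 0 A) by apply: (env_agree _ a2) => //; split; rewrite //= a1.2.
    have ru2 : regs s2 8 = u by rewrite a2.2.
    have ru21 : regs s2 9 = u * n by rewrite a2.2.
    apply: (@wp_le _ _ (cost (Defs.Sub (edge 8 10) (Add (get 0 8) (get 0 10))) + 10).+1); last first.
      by rewrite /= !cost_get cost_edge.
    apply: wp_if.
    rewrite /= (eval_edge (u := u) e2 ru21 rv) (eval_get 0 e2 ru2) (eval_get 0 e2 rv)
      [store_set _ _ _ 0]/store_set /=.
    have -> : (G u v - ((u \in A) + (v \in A)) != 0) = G u v && (u \notin A) && (v \notin A).
      by case: (G u v); case: (u \in A); case: (v \in A).
    rewrite /cover_pair; case: ifP => _.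
      apply: (wp_seq (T1 := 0.*2 + 4 + 1) (T2 := 0.*2 + 4 + 1)).
      apply: (wp_put (b := true) e2 ru2) => //; rewrite store_setT.
      set s3 := State _ _.
      have e3 : env s3 (store_set M 0 (u |: A)) by case: e2.
      apply: (wp_put (b := true) e3 rv) => //; rewrite store_setT.
      by split=> //; split=> //= z lt_z; rewrite a2.2.
    by apply: wp_le (wp_skip _) _.
  move=> s2 _ a2; split; rewrite ?a2.2 //.
  by split; [exact: a2.1 | move=> z lt_z; rewrite a2.2 ?a1.2 //; lia].
by move=> s1 _; apply: post.
Qed.

(** Registers 1, 2 and 3 receive [n * n], the number of digits and, by doubling, the number of
    strings. The program depends on the literal [r] only, not on the graph. *)
Definition Main r :=
  Seq (For 5 0 (Assign 1 (Add (Reg 1) (Reg 0))))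
 (Seq FindCover
 (Seq (For 5 0 (If (get 0 5) (Assign 2 (Add (Reg 2) (Lit r))) Skip))
 (Seq (Assign 3 (Lit 1))
 (Seq (For 5 2 (Assign 3 (Add (Reg 3) (Reg 3))))
 (Seq (For 5 3 Try)
      (For 5 0 (Store (Reg 5) (Defs.Sub (Lit 1) (get 3 5))))))))).

Lemma foldl_double N : foldl (fun a _ => a + a) 1 (iota 0 N) = 2 ^ N.
Proof.
by elim: N => // N IH; rewrite -[N.+1]addn1 iotaD foldl_cat IH /= addn1 expnS mul2n addnn.
Qed.

(** One factor [w] counts the digit strings; the other is the cost of reading one of them by
    repeated halving. *)
Lemma wp_main r :
  let C := greedy_cover G in let w := 2 ^ (r * #|C|) in
  wp (input G) (Main r) (5000 * (n.+1 ^ 4 * w ^ 2))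
     (fun s' => output n s' = ~: (search G C w).2).
Proof.
move=> C w; set L := r * #|C| in w *.
have w0 : 0 < w by rewrite expn_gt0.
apply: (@wp_le _ _ ((4 + 20) * n.+1 + (100 * n.+1 * n.+1 + ((9 + 20) * n.+1 + (2 +
  ((4 + 20) * L.+1 + ((2000 * (n.+1 * n.+1 * n.+1 * n.+1) * w + 20) * w.+1 +
   (14 + 20) * n.+1))))))); last first.
  have : 0 < n.+1 by []; move: n.+1 => u u0.
  have h2 : u * u <= u * u * u * u by rewrite -mulnA leq_pmulr // muln_gt0 u0.
  have h1 : u <= u * u * u * u by apply: leq_trans h2; rewrite leq_pmulr.
  have h0 : 0 < u * u * u * u by apply: leq_trans h1.
  have hL : L.+1 <= w by rewrite /w ltn_expl.
  have -> : u ^ 4 = u * u * u * u by rewrite !expnS !mulnA muln1.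
  have -> : w ^ 2 = w * w by rewrite mulnn.
  have -> : 100 * u * u = 100 * (u * u) by rewrite mulnA.
  move: (u * u) (u * u * u * u) h0 h1 h2 => u2 u4 h0 h1 h2.
  have h3 := leq_pmulr u4 w0; have h4 : u4 * w <= u4 * (w * w) by rewrite leq_mul2l leq_pmulr ?orbT.
  have h5 : w <= u4 * w by rewrite leq_pmull.
  have -> : (2000 * u4 * w + 20) * w.+1 = 2000 * (u4 * (w * w)) + 2000 * (u4 * w) + 20 * w + 20 by nia.
  move: (u4 * (w * w)) (u4 * w) h3 h4 h5 => x y; lia.
pose M0 := fun _ : nat => set0 : {set 'I_n}.
set s := input G; have cs : cells s = memory M0 by apply: memory_input.
apply: wp_seq.
apply: (wp_forV (f := fun a _ => a + n) (I := fun=> True) (X0 := 0) (st := fun a => set_reg s 1 a)) => //.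
- by split=> //= z _; case: (z =P 1) => // ->.
- move=> a v s1 _ a1 rx rx1; split=> //.
  apply: wp_assign; split=> //=; split=> /=; first exact: a1.1.
  by move=> z lt_z; rewrite !a1.2 //=; case: eqP.
rewrite (foldl_add (fun=> n)) big_enum sum_nat_const card_ord add0n => s1 _ a1.
have e1 : env s1 M0 by split; rewrite ?a1.2 // a1.1.
apply/wp_seq/(wp_find_cover e1) => //; rewrite -/C => s2 a2; pose M1 := store_set M0 0 C.
have e2 : env s2 M1 by apply: (env_agree _ a2) => //; case: e1.
have r2 z : 1 < z -> z < 5 -> regs s2 z = 0.
  move=> z1 z5; rewrite a2.2 /=; last by lia.
  rewrite a1.2 //= ifN; last by lia.
  by rewrite ifN //; lia.
apply: wp_seq.
apply: (wp_forV (f := fun a v => a + r * (v \in C)) (I := fun=> True) (X0 := 0)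
  (st := fun a => set_reg s2 2 a)) => //.
- by move=> a _; case: e2.
- by split=> //= z _; case: eqP => // ->; rewrite r2.
- move=> a v s3 _ a3 rx rx1; split=> //.
  have e3 : env s3 M1 by apply: (env_agree _ a3) => //; case: e2.
  apply: (@wp_le _ _ (cost (get 0 5) + 4).+1); last by rewrite cost_get.
  apply: wp_if; rewrite (eval_get 0 e3 rx) eqb0 negbK [M1 0]/=; case: ifP => vC.
    apply: wp_assign; split=> //=; split=> /=; first exact: a3.1.
    by move=> z lt_z; rewrite !a3.2 //= muln1; case: eqP.
  by apply: wp_le (wp_skip _) _; rewrite ?muln0 ?addn0.
have -> : foldl (fun a v => a + r * (v \in C)) 0 (enum 'I_n) = L.
  rewrite foldl_add add0n -big_distrr /= big_enum /= /L -sum1_card [in RHS]big_mkcond.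
  by congr (_ * _); apply: eq_bigr => v _; case: ifP.
move=> s3 _ a3; apply/wp_seq/wp_assign/wp_seq.
apply: (wp_for (f := fun a _ => a + a) (I := fun=> True) (X0 := 1) (n := n) (N := L)
   (st := fun a => set_reg (set_reg s2 2 L) 3 a)) => //.
- by move=> a _; split=> //; case: e2.
- by split=> /=; [exact: a3.1 | move=> z lt_z; case: eqP => // _; exact: a3.2].
- move=> a i s4 _ _ a4 rx rx1; split=> //.
  apply: wp_assign; split=> //=; split=> /=; first exact: a4.1.
  by move=> z lt_z; rewrite !a4.2 //=; case: eqP.
rewrite foldl_double -/w => s4 _ a4; apply: wp_seq.
have e4 : env s4 M1 by apply: (env_agree _ a4) => //; case: e2.
pose st (bB : nat * {set 'I_n}) :=
  State (upd (regs s4) 4 bB.1) (memory (store_set M1 3 bB.2)).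
apply: (wp_for (f := attempt G C) (I := fun=> True) (X0 := (0, set0)) (n := n) (N := w) (st := st)) => //.
- by move=> bB _; split; rewrite /= ?a4.2 //; case: e2.
- split=> /=; last by move=> z lt_z; case: eqP => // ->; rewrite a4.2 //= r2.
  by case: e4 => _ _ ->; congr memory; apply/funext => k; rewrite /M1 /store_set; case: (k =P 3) => // ->.
- move=> [b B] j s5 jw _ a5 rx rx1; split=> //.
  have e5 : env s5 (store_set M1 3 B) by apply: (env_agree _ a5) => //; case: e4.
  apply: (wp_try (w := w) e5) => //; rewrite rx // a5.2 //= => s6 a6.
  split; rewrite ?a6.2 //=.
  split; first by rewrite a6.1 /= store_setT.
  move=> z lt_z; rewrite a6.2 /=; last by lia.
  by case: eqP => // ne; rewrite a5.2 //=; case: eqP.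
rewrite -/(search G C w) => s5 _ a5; set B := _.2 in a5 *.
have e5 : env s5 (store_set M1 3 B) by apply: (env_agree _ a5) => //; case: e4.
have [r50 r51 c5] := e5.
(* The output overwrites part of the adjacency matrix, so raw cells are tracked; only cells below
   [n] are written, so array 3 stays intact. *)
apply: (wp_forV (X := nat -> nat) (I := fun Y => forall v, Y (3 * n + n * n + v) = (v \in B))
  (f := fun Y v => upd Y v (v \notin B)) (st := State (regs s5)) (X0 := cells s5)) => //.
- by move=> v; rewrite c5 memory_get.
- move=> Y v s6 IY a6 rx rx1; split.
    move=> u; rewrite /upd; case: eqP => // E; have := ltn_ord v; lia.
  apply: (@wp_le _ _ (1 + cost (Defs.Sub (Lit 1) (get 3 5))).+1); last by rewrite /= cost_get.
  apply: wp_store; rewrite [eval s6 (Reg 5)]/= rx.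
  have -> : eval s6 (Defs.Sub (Lit 1) (get 3 5)) = (v \notin B).
    have r60 : regs s6 0 = n by rewrite a6.2.
    have r61 : regs s6 1 = n * n by rewrite a6.2.
    by rewrite /= (eval_get_cell _ _ r60 r61) rx a6.1 /= IY; case: (v \in B).
  split=> //; split=> //=; [by rewrite a6.1 | by move=> z lt_z; rewrite a6.2].
move=> s6 _ a6; apply/setP => v; rewrite !inE a6.1 /=.
have H l (Y : nat -> nat) (u : 'I_n) : foldl (fun (Y : nat -> nat) v => upd Y v (v \notin B)) Y l u =
    if u \in l then (u \notin B : nat) else Y u.
  elim: l Y => //= x l IH Y; rewrite IH inE; case: (u \in l); rewrite ?orbT ?orbF //.
  by case: (eqVneq u x) => [->|ne]; rewrite /upd ?eqxx // ifN.
by rewrite H mem_enum /=; case: (v \in B).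
Qed.

End Programs.

(** * Approximation ratio and running time over the reals *)

Import Order.TTheory GRing.Theory Num.Theory.
Local Open Scope ring_scope.

(** From [r * k <= m] follows [2 * k <= eps * m], so [(1 - eps) * (k + m)] is at most [m - k], hence
    at most [s]. *)
Lemma large_crossing (R : realType) (eps : R) (k m r s o : nat) :
  0 < eps -> 2 <= eps * r%:R -> (r.+1 * k <= k + m)%N -> (m <= s + k)%N ->
  (o <= k + m)%N -> eps <= 1 -> (1 - eps) * o%:R <= s%:R.
Proof.
move=> eps0 hr rk ms ok eps1.
have rk' : (r * k)%:R <= m%:R :> R by rewrite ler_nat; lia.
have ms' : m%:R <= s%:R + k%:R :> R by rewrite -natrD ler_nat.
have ok' : o%:R <= k%:R + m%:R :> R by rewrite -natrD ler_nat.
have k0 : 0 <= k%:R :> R by [].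
rewrite natrM in rk'.
have h1 : 2 * k%:R <= eps * m%:R.
  apply: (@le_trans _ _ (eps * r%:R * k%:R)); first exact: ler_wpM2r.
  by rewrite -mulrA ler_wpM2l // ltW.
have h2 : (1 - eps) * o%:R <= (1 - eps) * (k%:R + m%:R) by apply: ler_wpM2l => //; lra.
have h3 : 0 <= eps * k%:R by apply: mulr_ge0 => //; apply: ltW.
lra.
Qed.

(** The exponent is [2 * r * c], at most [2 * (4 / eps) * (2 * v)], whence the constant 16. *)
Lemma time_bound (R : realType) (eps : R) (n r c v : nat) :
  0 < eps -> r%:R <= 4 / eps -> (c <= 2 * v)%N ->
  (5000 * (n.+1 ^ 4 * (2 ^ (r * c)) ^ 2))%:R <=
    5000%:R * powR 2 (16%:R * (v%:R / eps)) * n.+1%:R ^+ 4 :> R.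
Proof.
move=> eps0 hr cv; rewrite -expnM 2!natrM 2!natrX [_ ^+ 4 * _]mulrC [leLHS]mulrA.
rewrite ler_wpM2r ?exprn_ge0 // ler_wpM2l // -powR_mulrn //.
apply: ler_powR; first by rewrite ler1n.
rewrite !natrM; have : c%:R <= 2 * v%:R :> R by rewrite -natrM ler_nat.
have -> : 16 * (v%:R / eps) = 4 / eps * (2 * v%:R) * 2 by field; rewrite gt_eqF.
by move=> cv'; rewrite ler_wpM2r // ler_pM.
Qed.

Lemma rounds_exist (R : realType) (eps : R) : 0 < eps ->
  exists r : nat, r%:R <= 4 / eps /\
    (eps < 1 -> exists2 q, r = q.+1 & 2 <= eps * q%:R).
Proof.
move=> eps0; case: (lerP 1 eps) => [eps1|eps1].
  (* For large [eps] the bound [4 / eps] may leave only [r = 0], that is, a single digit string. *)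
  by exists 0%N; rewrite divr_ge0 // ltW.
have /truncn_itv/andP[le1 lt1] : 0 <= 2 / eps by rewrite divr_ge0 // ltW.
(* One unit above [q >= 2 / eps] pays for the digits of the cover; [2 <= 2 / eps] absorbs the
   rounding. *)
exists (Num.truncn (2 / eps)).+2; split.
  rewrite -addn2 natrD; have : 2 <= 2 / eps by rewrite ler_pdivlMr //; lra.
  have -> : 4 / eps = 2 / eps + 2 / eps by rewrite -mulrDl; congr (_ / _); ring.
  lra.
move=> _; exists (Num.truncn (2 / eps)).+1 => //.
by rewrite mulrC -ler_pdivrMr // ltW.
Qed.

Theorem theorem3 (R : realType) :
  exists K a b : nat,
  forall eps : R, 0 < eps ->
  exists P : prog,
  forall (n : nat) (G : sgraph 'I_n),
  exists (t : nat) (s : state),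
    [/\ exec P (input G) t s,
        t%:R <= K%:R * powR 2 (a%:R * ((vc G)%:R / eps)) * n.+1%:R ^+ b,
        minimal_fvs G (output n s)
      & (1 - eps) * (opt G)%:R <= (#|output n s|%:R : R)].
Proof.
exists 5000%N, 16%N, 4%N => eps eps0; have [r [r_le r_eps]] := rounds_exist eps0.
exists (Main r) => n G; have [t [s [ex le_t outE]]] := wp_main G r.
have cover := greedy_cover_cover G.
have N0 : (0 < 2 ^ (r * #|greedy_cover G|))%N by rewrite expn_gt0.
have [min_out _ _] := search_minimal cover N0.
exists t, s; rewrite outE; split=> //.
  apply: le_trans (time_bound n eps0 r_le (greedy_cover_card G)).
  by rewrite ler_nat.
(* The maximum is attained because the output of the search shows that minimal feedback vertex sets
   exist. *)
have [S minS ->] : exists2 S, minimal_fvs G S & opt G = #|S|.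
  have : (0 < #|[set S | minimal_fvs G S]|)%N.
    by apply/card_gt0P; eexists; rewrite inE; apply: min_out.
  rewrite cardsE => /eq_bigmax_cond - /(_ (fun S => #|S|))[S mS E].
  by exists S.
(* If [eps >= 1], the required size is at most zero and minimality of the output is enough. *)
case: (lerP 1 eps) => [eps1|eps1].
  by apply: (@le_trans _ _ 0) => //; rewrite mulr_le0_ge0 // subr_le0.
have [q Er hq] := r_eps eps1; have r0 : (0 < r)%N by rewrite Er.
have [le_S|[m [rk mk Sk]]] := search_card cover r0 minS.
  apply: (@le_trans _ _ #|S|%:R); last by rewrite ler_nat.
  by rewrite ler_piMl //; lra.
by apply: large_crossing mk Sk (ltW eps1) => //; [exact: hq | rewrite -Er].
Qed.
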